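(* Let $S$ be a connected analytic submanifold of $\mathbb{R}^{n-1}$ and let $P,Q\in\mathbb{R}[\mathbf{x};x_n]$ have positive degrees $p_n$ and $q_n$ in $x_n$ respectively. Assume that $P$ and $Q$ never nullify on $S$ and that $P$ is projectively delineable over $S$. If $\mathrm{Res}^{p_n,q_n}_{x_n}(P,Q)$ is not the zero polynomial and is order-invariant over $S$, then for each projective root function $\theta$ of $P$ over $S$, either $H^{q_n}(Q)(\mathbf{x},u_{\mathbf{x}},v_{\mathbf{x}})=0$ for all $\mathbf{x}\in S$, or $H^{q_n}(Q)(\mathbf{x},u_{\mathbf{x}},v_{\mathbf{x}})\neq0$ for all $\mathbf{x}\in S$, where $(u_{\mathbf{x}},v_{\mathbf{x}})$ is any representative of $\theta(\mathbf{x})$.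
   Context: Write $\mathbf{x}=(x_1,\dots,x_{n-1})$; $E_{\mathbf{x}_0}P$ is the polynomial in $x_n$ obtained by substituting $\mathbf{x}_0$ for $\mathbf{x}$. ''$P$ never nullifies on $S$'' means $E_{\mathbf{x}}P\ne0$ for all $\mathbf{x}\in S$. $\mathrm{Res}^{p,q}_{x_n}(P,Q)\in\mathbb{R}[\mathbf{x}]$ is the resultant with respect to $x_n$ computed for formal degrees $(p,q)$ (Sylvester determinant of size $p+q$), so $E_{\mathbf{x}}\mathrm{Res}^{p,q}_{x_n}(P,Q)=\mathrm{Res}^{p,q}(E_{\mathbf{x}}P,E_{\mathbf{x}}Q)$. For a polynomial $f$ and a point $v$, $\mathrm{ord}(f,v)$ is the least total order of a partial derivative of $f$ nonzero at $v$; order-invariant on $S$ means constant order on $S$. $\mathbb{RP}^1$ is the quotient of $\mathbb{R}^2\setminus\{(0,0)\}$ by proportionality with the quotient topology; $(u:v)$ is the class of $(u,v)$. For $P=\sum_kc_k(\mathbf{x})x_n^k$ and $d\ge\deg_{x_n}P$, $H^{d}(P)(\mathbf{x},x_n,y)=\sum_kc_k(\mathbf{x})x_n^ky^{d-k}$. A projective root of a binary form $g(u,v)$ is $(u_0:v_0)$ with $g(u_0,v_0)=0$, with multiplicity (for $g\ne0$) the largest $m$ with $(v_0u-u_0v)^m\mid g$. $Z_{\mathbb{RP}^1}(P,S)=\{(\mathbf{x},(x_n:y))\in S\times\mathbb{RP}^1: H^{p_n}(P)(\mathbf{x},x_n,y)=0\}$. $P$ is projectively delineable on $S$ if there are $k\in\mathbb{N}$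 and continuous $\theta_1,\dots,\theta_k:S\to\mathbb{RP}^1$ (the projective root functions) such that $Z_{\mathbb{RP}^1}(P,S)$ is the disjoint union of their graphs and, for each $l$, there is $m_l\ge1$ with $\theta_l(\mathbf{x})$ a projective root of $E_{\mathbf{x}}H^{p_n}(P)$ of multiplicity $m_l$ for all $\mathbf{x}\in S$. *)

(* Defs.v *)
From HB Require Import structures.
From mathcomp Require Import all_boot all_order all_algebra.
From mathcomp Require Import reals.
From mathcomp Require Import mpoly.

Set Implicit Arguments.
Unset Strict Implicit.
Unset Printing Implicit Defensive.

Import Order.TTheory GRing.Theory Num.Theory.
Local Open Scope ring_scope.

Section Defs.
Variable R : realType.

Definition pt (m : nat) := 'I_m -> R.

Definition inball m (a : pt m) (r : R) (x : pt m) := forall i, `|x i - a i| < r.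

Definition open_set m (U : pt m -> Prop) :=
  forall a, U a -> exists2 r : R, 0 < r & forall x, inball a r x -> U x.

Definition rel_open m (S V : pt m -> Prop) :=
  (forall x, V x -> S x) /\
  forall a, V a -> exists2 r : R, 0 < r & forall x, S x -> inball a r x -> V x.

Definition connected m (S : pt m -> Prop) :=
  forall A : pt m -> Prop, rel_open S A -> rel_open S (fun x => S x /\ ~ A x) ->
  (forall x, ~ A x) \/ (forall x, S x -> A x).

(* real analytic functions on an open set W of R^d: locally the sum of an
   absolutely convergent power series (partial sums over cubes of multi-indices) *)
Definition ps_partial d (c : ('I_d -> nat) -> R) (a y : pt d) (N : nat) : R :=
  \sum_(al : {ffun 'I_d -> 'I_N.+1})
     c (fun i => nat_of_ord (al i)) * \prod_i (y i - a i) ^+ al i.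

Definition ps_abs_partial d (c : ('I_d -> nat) -> R) (a y : pt d) (N : nat) : R :=
  \sum_(al : {ffun 'I_d -> 'I_N.+1})
     `|c (fun i => nat_of_ord (al i))| * \prod_i `|y i - a i| ^+ al i.

Definition analytic_on d (W : pt d -> Prop) (g : pt d -> R) :=
  forall a, W a -> exists2 r : R, 0 < r & exists c : ('I_d -> nat) -> R,
    forall y, inball a r y ->
      W y /\ (exists B : R, forall N, ps_abs_partial c a y N <= B) /\
      (forall eps : R, 0 < eps -> exists N0, forall N, (N0 <= N)%N ->
          `|ps_partial c a y N - g y| < eps).

(* analytic submanifold of R^m (of dimension d): locally, after a permutation
   of the coordinates, the graph of an analytic map over an open set of R^d *)
Definition analytic_submanifold m (S : pt m -> Prop) :=
  exists d : nat, forall a, S a ->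
    exists e : nat, exists sigma : 'I_(d + e) -> 'I_m, bijective sigma /\
    exists U : pt m -> Prop, open_set U /\ U a /\
    exists W : pt d -> Prop, open_set W /\
    exists g : 'I_e -> pt d -> R, (forall j, analytic_on W (g j)) /\
    forall x, U x ->
      (S x <-> (W (fun i => x (sigma (lshift e i))) /\
                forall j, x (sigma (rshift d j)) = g j (fun i => x (sigma (lshift e i))))).

Definition pclass (w : R * R) : R * R -> Prop :=
  fun w' => exists2 l : R, l != 0 & w' = (l * w.1, l * w.2).

Record RP1 := MkRP1 {
  rp_set : R * R -> Prop;
  rp_ax : exists w : R * R, w != (0, 0) /\ rp_set = pclass w }.

(* quotient topology: U is open iff its preimage in R^2 \ {0} is open *)
Definition rp1_open (U : RP1 -> Prop) :=
  forall w : R * R, w != (0, 0) -> (exists c, U c /\ rp_set c w) ->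
    exists2 r : R, 0 < r & forall w' : R * R, `|w'.1 - w.1| < r -> `|w'.2 - w.2| < r ->
      w' != (0, 0) /\ exists c, U c /\ rp_set c w'.

Definition continuous_on_RP1 m (S : pt m -> Prop) (f : pt m -> RP1) :=
  forall U, rp1_open U -> rel_open S (fun x => S x /\ U (f x)).

Variable m : nat.

(* P in R[x; x_n] is represented as a polynomial in x_n with coefficients in R[x] *)
Definition degn (P : {poly {mpoly R[m]}}) : nat := (size P).-1.

Definition Eval (x : pt m) (P : {poly {mpoly R[m]}}) : {poly R} :=
  map_poly (fun c : {mpoly R[m]} => c.@[x]) P.

Definition never_nullifies (S : pt m -> Prop) (P : {poly {mpoly R[m]}}) :=
  forall x, S x -> Eval x P != 0.

Definition Hval (d : nat) (P : {poly {mpoly R[m]}}) (x : pt m) (w : R * R) : R :=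
  \sum_(k < d.+1) (P`_k).@[x] * w.1 ^+ k * w.2 ^+ (d - k).

(* binary forms g(u,v) as elements of R[v][u] (outer variable u, inner v) *)
Definition bf_eval (g : {poly {poly R}}) (w : R * R) : R := (g.[w.1%:P]).[w.2].

Definition Ehom (d : nat) (P : {poly {mpoly R[m]}}) (x : pt m) : {poly {poly R}} :=
  \sum_(k < d.+1) ((P`_k).@[x] *: 'X^(d - k))%:P * 'X^k.

Definition linform (w : R * R) : {poly {poly R}} := (w.2%:P)%:P * 'X - (w.1 *: 'X)%:P.

Definition bf_divides (l g : {poly {poly R}}) := exists h, g = l * h.

Definition bf_mult (g : {poly {poly R}}) (w : R * R) (mu : nat) :=
  bf_divides (linform w ^+ mu) g /\
  forall mu', bf_divides (linform w ^+ mu') g -> (mu' <= mu)%N.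

Definition proj_root_mult (g : {poly {poly R}}) (c : RP1) (mu : nat) :=
  forall w, rp_set c w -> bf_eval g w = 0 /\ bf_mult g w mu.

Definition proj_delin_family (S : pt m -> Prop) (P : {poly {mpoly R[m]}})
    (k : nat) (theta : 'I_k -> pt m -> RP1) :=
  (forall l, continuous_on_RP1 S (theta l)) /\
  (forall x, S x -> forall w : R * R, w != (0, 0) ->
      (Hval (degn P) P x w = 0 <-> exists l, rp_set (theta l x) w)) /\
  (forall l l', l != l' -> forall x, S x -> forall w,
      ~ (rp_set (theta l x) w /\ rp_set (theta l' x) w)) /\
  (forall l, exists2 mu, (0 < mu)%N &
      forall x, S x -> proj_root_mult (Ehom (degn P) P x) (theta l x) mu).

Definition proj_delineable (S : pt m -> Prop) (P : {poly {mpoly R[m]}}) :=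
  exists k (theta : 'I_k -> pt m -> RP1), proj_delin_family S P theta.

Definition mderivs (s : seq 'I_m) (f : {mpoly R[m]}) : {mpoly R[m]} :=
  foldr (fun i g => mderiv i g) f s.

Definition ord_is (f : {mpoly R[m]}) (v : pt m) (k : nat) :=
  (forall s : seq 'I_m, (size s < k)%N -> (mderivs s f).@[v] = 0) /\
  exists s : seq 'I_m, size s = k /\ (mderivs s f).@[v] != 0.

Definition order_invariant (S : pt m -> Prop) (f : {mpoly R[m]}) :=
  exists k, forall v, S v -> ord_is f v k.

End Defs.

(* Main.v *)
Require Import Defs.
From HB Require Import structures.
From mathcomp Require Import all_boot all_order all_algebra.
From mathcomp Require Import reals.
From mathcomp Require Import mpoly.
From mathcomp Require Import boolp ring lra.

(** Fix [x0] in [S]. After a shear of the projective line, [P(x0, .)] has no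
    root at infinity and the root function is an affine function [a(x)] near
    [x0]. Choose a line direction [d] along which the resultant has order
    exactly [k] at [x0], and put [P_x(t, z) := P(x + t d, z)], and likewise
    [Q_x]. Modulo [t^(k+1)], the algebra [R[t][z]/(P_x)] splits as the part
    over [z = a(x)] times the rest (lifting of idempotents), so that the norm
    of [Q_x], which is the resultant along the line up to a unit, becomes a
    product [U_x V_x] whose coefficients depend continuously on [x]. Orders at
    [t = 0] can only drop near [x0]; as the order of the product is at least
    [k] on [S], that of [U_x] is constant near [x0]. Since [U_x(0) = 0]
    exactly when [Q(x, a(x)) = 0], the vanishing locus of [Q] along the root
    function is open and closed in [S]. *)

Set Implicit Arguments.
Unset Strict Implicit.
Unset Printing Implicit Defensive.
Import Order.TTheory GRing.Theory Num.Theory.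
Local Open Scope ring_scope.

(** * Sylvester matrices, shears and companion matrices *)

(* Unlike [Sylvester_mx], the formal degrees are parameters, so that the matrix
   is compatible with ring morphisms that lower the degrees. *)
Definition sylvester (A : nzRingType) (p q : nat) (P Q : {poly A}) : 'M[A]_(q + p) :=
  col_mx (lin1_mx (poly_rV \o P \o* rVpoly)) (lin1_mx (poly_rV \o Q \o* rVpoly)).

Lemma mul_sylvester (A : nzRingType) p q (P Q : {poly A}) (u : 'rV[A]_q) (v : 'rV[A]_p) :
  row_mx u v *m sylvester p q P Q = poly_rV (rVpoly u * P + rVpoly v * Q).
Proof. by rewrite mul_row_col !mul_rV_lin1 /= linearD. Qed.

Lemma eq_mulmx_rV (A : nzRingType) m n (M N : 'M[A]_(m, n)) :
  (forall u : 'rV_m, u *m M = u *m N) -> M = N.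
Proof. by move=> eqMN; apply/row_matrixP => i; rewrite !rowE. Qed.

(** * Homogenized evaluation at a pair of ring elements *)

Section HomSubst.
Variables (A B : comNzRingType) (f : {rmorphism A -> B}).
Implicit Types (F G : {poly A}) (a b : B).

(* The value at (a, b) of the degree d homogenization of F. *)
Definition hsub d F a b : B := \sum_(k < d.+1) f F`_k * a ^+ k * b ^+ (d - k).

Lemma hsubD d F G a b : hsub d (F + G) a b = hsub d F a b + hsub d G a b.
Proof. by rewrite /hsub -big_split; apply: eq_bigr => i _; rewrite coefD rmorphD !mulrDl. Qed.

Lemma hsub0 d a b : hsub d 0 a b = 0.
Proof. by rewrite /hsub big1 // => i _; rewrite coef0 rmorph0 !mul0r. Qed.

Lemma hsub_sum d I (r : seq I) (h : I -> {poly A}) a b :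
  hsub d (\sum_(i <- r) h i) a b = \sum_(i <- r) hsub d (h i) a b.
Proof.
elim: r => [|i r IH]; first by rewrite !big_nil hsub0.
by rewrite !big_cons hsubD IH.
Qed.

Lemma hsubZX d c i a b : (i <= d)%N -> hsub d (c *: 'X^i) a b = f c * a ^+ i * b ^+ (d - i).
Proof.
move=> led; rewrite /hsub (bigD1 (Ordinal (led : (i < d.+1)%N))) //= coefZ coefXn eqxx mulr1.
rewrite big1 ?addr0 // => j neji; rewrite coefZ coefXn.
rewrite (_ : (j == i :> nat) = false) ?mulr0 ?rmorph0 ?mul0r //.
by apply: contraNF neji => /eqP e; apply/eqP/val_inj.
Qed.

Lemma poly_sum_le d F : (size F <= d)%N -> F = \sum_(i < d) F`_i *: 'X^i.
Proof.
move=> szF; rewrite -poly_def; apply/polyP => i; rewrite coef_poly.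
by case: ltnP => // ledi; rewrite nth_default // (leq_trans szF).
Qed.

(** By bilinearity it is enough to treat monomials. The size bounds matter: [hsub d] drops all
    coefficients above degree [d]. *)
Lemma hsubM d e F G a b : (size F <= d.+1)%N -> (size G <= e.+1)%N ->
  hsub (d + e) (F * G) a b = hsub d F a b * hsub e G a b.
Proof.
move=> szF szG; rewrite {1}(poly_sum_le szF) {1}(poly_sum_le szG) big_distrlr /= hsub_sum.
rewrite [RHS]big_distrlr /=; apply: eq_bigr => i _; rewrite hsub_sum; apply: eq_bigr => j _.
rewrite -scalerAl -scalerAr scalerA -exprD hsubZX; last first.
  by apply: leq_add; rewrite -ltnS.
rewrite rmorphM exprD (_ : (d + e - (i + j)) = (d - i) + (e - j))%N ?exprD.
  by rewrite /=; ring.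
by rewrite addnBA -1?ltnS // subnDA addnBAC // -ltnS.
Qed.

Lemma hsubXn d n F a b : (size F <= d.+1)%N ->
  hsub (n * d) (F ^+ n) a b = hsub d F a b ^+ n.
Proof.
move=> szF; elim: n => [|n IH].
  by rewrite mul0n !expr0 /hsub big_ord1 coefC eqxx rmorph1 !expr0 !mulr1.
rewrite !exprS mulSn hsubM ?IH //.
by rewrite (leq_trans (size_poly_exp_leq _ _)) // mulnC ltnS leq_mul2l -subn1 leq_subLR szF orbT.
Qed.

Lemma hsub_scale d F l a b : hsub d F (l * a) (l * b) = l ^+ d * hsub d F a b.
Proof.
rewrite /hsub mulr_sumr; apply: eq_bigr => i _; rewrite !exprMn.
have -> : l ^+ d = l ^+ i * l ^+ (d - i) by rewrite -exprD subnKC // -ltnS.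
ring.
Qed.
End HomSubst.

Lemma rmorph_hsub (A B C : comNzRingType) (f : {rmorphism A -> B})
    (g : {rmorphism B -> C}) (h : {rmorphism A -> C}) d F a b :
  (forall c, h c = g (f c)) ->
  g (hsub f d F a b) = hsub h d F (g a) (g b).
Proof.
move=> hE; rewrite /hsub rmorph_sum; apply: eq_bigr => i _.
by rewrite !rmorphM !rmorphXn hE.
Qed.


Lemma size_mul_le (A : nzSemiRingType) d e (F G : {poly A}) :
  (size F <= d.+1)%N -> (size G <= e.+1)%N -> (size (F * G)%R <= (d + e).+1)%N.
Proof.
move=> szF szG; apply: leq_trans (size_polyMleq _ _) _.
by rewrite -subn1 leq_subLR add1n -addSn -addnS leq_add.
Qed.

Lemma size_exp_le (A : nzSemiRingType) d n (F : {poly A}) :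
  (size F <= d.+1)%N -> (size (F ^+ n)%R <= (n * d).+1)%N.
Proof.
move=> szF; elim: n => [|n IH]; first by rewrite expr0 size_poly1.
by rewrite exprS mulSn size_mul_le.
Qed.

(** * Invariance of the resultant under a shear of the projective line *)

Section Shear.
Variables (A : comNzRingType) (lam : A).
Implicit Types F P Q : {poly A}.

(* The binary form of F after the substitution v := v + lam u. *)
Definition shear d F : {poly A} := hsub polyC d F 'X (1 + lam *: 'X).

Lemma size_1DZX : (size (1 + lam *: 'X)%R <= 2)%N.
Proof.
apply: (leq_trans (size_polyD _ _)); rewrite size_poly1 geq_max /=.
by rewrite (leq_trans (size_scale_leq _ _)) // size_polyX.
Qed.

Lemma size_shear d F : (size (shear d F) <= d.+1)%N.
Proof.
apply: (leq_trans (size_sum _ _ _)); apply/bigmax_leqP => i _.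
have led : (i <= d)%N by rewrite -ltnS.
rewrite -mulrA mul_polyC (leq_trans (size_scale_leq _ _)) //.
apply: leq_trans (size_mul_le (d := i) (e := d - i) _ _) _; rewrite ?size_polyXn ?subnKC //.
by rewrite (leq_trans (size_exp_le _ size_1DZX)) // muln1.
Qed.

(** Rows of length [n] stand for binary forms of degree [n.-1], and the matrix acts on them from the
    right. *)
Definition shear_mx n : 'M[A]_n := \matrix_(i < n) poly_rV (shear n.-1 'X^i).

Lemma mul_poly_rV_shear n F : (size F <= n)%N ->
  poly_rV F *m shear_mx n = poly_rV (shear n.-1 F).
Proof.
case: n => [|n] szF; first by apply/rowP => -[].
rewrite mulmx_sum_row {2}(poly_sum_le szF) /shear hsub_sum linear_sum.
apply: eq_bigr => i _ /=.
have led : (i <= n)%N by rewrite -ltnS.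
rewrite rowK mxE -linearZ hsubZX //; congr poly_rV.
by rewrite /shear -[X in hsub _ _ X]scale1r hsubZX // mul1r -mul_polyC mulrA.
Qed.

(** The image of ['X^i] is ['X^i] times a power of [1 + lam *: 'X], with lowest term ['X^i], so the
    matrix is unitriangular. *)
Lemma det_shear_mx n : \det (shear_mx n) = 1.
Proof.
rewrite -det_tr det_trig; first last.
  apply/is_trig_mxP => i j ltij; rewrite !mxE /shear -[X in hsub _ _ X]scale1r hsubZX; last first.
    by case: (n) j {ltij} => [[]|n'] // j; rewrite -ltnS.
  by rewrite mul1r mulrC coefMXn ltij.
rewrite big1 // => i _; rewrite !mxE /shear -[X in hsub _ _ X]scale1r hsubZX; last first.
  by case: (n) i => [[]|n'] // i; rewrite -ltnS.
rewrite mul1r mulrC coefMXn ltnn subnn -horner_coef0 horner_exp !hornerE.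
by rewrite expr1n.
Qed.

Lemma shear0 d : shear d 0 = 0.
Proof. exact: hsub0. Qed.

(** The shear is multiplicative for formal degrees: shearing [u * P + v * Q] amounts to shearing [P]
    and [Q] together with the multipliers [u] and [v]. All shear matrices involved have determinant
    1. *)
Lemma det_sylvester_shear p q P Q : (size P <= p.+1)%N -> (size Q <= q.+1)%N ->
  \det (sylvester p q (shear p P) (shear q Q)) = \det (sylvester p q P Q).
Proof.
move=> szP szQ; rewrite -[RHS]mulr1 -(det_shear_mx (q + p)) -det_mulmx.
have -> : sylvester p q P Q *m shear_mx (q + p) =
    block_mx (shear_mx q) 0 0 (shear_mx p) *m sylvester p q (shear p P) (shear q Q).
  apply: eq_mulmx_rV => w; rewrite -[w]hsubmxK; set u := lsubmx w; set v := rsubmx w.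
  rewrite !mulmxA mul_sylvester mul_row_block !mulmx0 addr0 add0r mul_sylvester.
  (* For [e = 0] the truncated predecessor [e.-1] is not the right formal degree, but then the
     multiplier [H] is zero. *)
  have rV (d e : nat) (G H : {poly A}) : (size G <= d.+1)%N -> (size H <= e)%N ->
      (size (H * G)%R <= e + d)%N /\ shear (e + d).-1 (H * G) = shear e.-1 H * shear d G.
    case: e => [|e] szG; last by split; [exact: size_mul_le | rewrite addSn /= /shear hsubM].
    by rewrite leqn0 size_poly_eq0 => /eqP ->; rewrite mul0r size_poly0 !shear0 mul0r.
  have rVs e (x : 'rV[A]_e) : rVpoly (x *m shear_mx e) = shear e.-1 (rVpoly x).
    rewrite -[x in LHS]rVpolyK mul_poly_rV_shear ?size_poly // poly_rV_K //.
    case: e x => [|e] x; last exact: size_shear.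
    by rewrite (_ : x = 0) ?linear0 ?shear0 ?size_poly0 //; apply/rowP => -[].
  have [sz1 sh1] := rV _ _ _ _ szP (size_poly q _ : (size (rVpoly u) <= q)%N).
  have [sz2 sh2] := rV _ _ _ _ szQ (size_poly p _ : (size (rVpoly v) <= p)%N).
  rewrite mul_poly_rV_shear; last first.
    by rewrite (leq_trans (size_polyD _ _)) // geq_max sz1 addnC sz2.
  by rewrite /shear hsubD -!/(shear _ _) sh1 [(q + p)%N]addnC sh2 !rVs.
by rewrite det_mulmx det_ublock !det_shear_mx !mul1r.
Qed.
End Shear.

(** * The resultant as a norm from the quotient by a monic polynomial *)

Section Companion.
Variables (A : comNzRingType) (p' : nat).
Local Notation p := p'.+1.
Variable P : {poly A}.
Implicit Types F Q : {poly A}.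

(** For [P] monic of degree [p], this is multiplication by ['X] modulo [P] in the basis of powers of
    ['X], acting on row vectors. *)
Definition comp_mx : 'M[A]_p :=
  \matrix_(i < p, j < p) if i == p' :> nat then - P`_j else (i.+1 == j :> nat)%:R.

Hypotheses (monP : P \is monic) (szP : size P = p.+1).

Lemma delta_comp_mx_exp (i : 'I_p) : delta_mx 0 0 *m (comp_mx ^+ i) = delta_mx 0 i :> 'rV_p.
Proof.
case: i => i; elim: i => [|i IH] lti; first by rewrite expr0 mulmx1; congr delta_mx; apply: val_inj.
rewrite exprSr -mulmxE mulmxA (IH (ltnW lti)) -rowE; apply/rowP => j; rewrite !mxE /=.
by rewrite ltn_eqF // eq_sym.
Qed.

(** The row [delta_mx 0 0] is the class of 1, so acting by [F] yields the class of [F], which is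
    already reduced. *)
Lemma delta_horner_comp F : (size F <= p)%N -> delta_mx 0 0 *m horner_mx comp_mx F = poly_rV F.
Proof.
move=> szF; rewrite {1}(poly_sum_le szF) rmorph_sum mulmx_sumr /=.
apply/rowP => j; rewrite !mxE summxE (bigD1 j) //= big1 ?addr0 => [|i /negPf neij];
  rewrite linearZ /= rmorphXn /= horner_mx_X -scalemxAr delta_comp_mx_exp !mxE.
  by rewrite !eqxx mulr1.
by rewrite eqxx eq_sym neij mulr0.
Qed.

(** The matrix on the left kills the class of 1, and it commutes with the powers of [comp_mx], which
    carry that class to every basis vector. *)
Lemma horner_comp_mx0 : horner_mx comp_mx P = 0.
Proof.
have d0 : delta_mx 0 0 *m horner_mx comp_mx P = 0 :> 'rV_p.
  have szP' : (size P <= p.+1)%N by rewrite szP.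
  rewrite {1}(poly_sum_le szP') big_ord_recr /= rmorphD mulmxDr /=.
  rewrite delta_horner_comp; last first.
    apply: (leq_trans (size_sum _ _ _)); apply/bigmax_leqP => i _.
    by rewrite (leq_trans (size_scale_leq _ _)) // size_polyXn.
  have -> : P`_p = 1 by move: monP; rewrite monicE /lead_coef szP => /eqP.
  rewrite scale1r rmorphXn /= horner_mx_X exprSr -mulmxE mulmxA.
  rewrite (delta_comp_mx_exp ord_max) -rowE; apply/rowP => j; rewrite !mxE eqxx.
  by rewrite -poly_def coef_poly ltn_ord subrr.
apply/row_matrixP => i; rewrite row0 rowE -delta_comp_mx_exp -mulmxA.
have -> : comp_mx ^+ i = horner_mx comp_mx 'X^i by rewrite rmorphXn /= horner_mx_X.
by rewrite mulmxE -rmorphM mulrC rmorphM -mulmxE mulmxA d0 mul0mx.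
Qed.

Import Pdiv.RingMonic Pdiv.CommonRing.

Lemma size_rdivp_monic q F : (size F <= q + p)%N -> (size (rdivp F P) <= q)%N.
Proof.
move=> szF; rewrite leqNgt; apply/negP => ltq.
have qn0 : rdivp F P != 0 by rewrite -size_poly_gt0 (leq_trans _ ltq).
have szqP : size (rdivp F P * P) = (size (rdivp F P) + p)%N.
  by rewrite size_Mmonic // szP addnS.
have : (size (rdivp F P * P)%R <= q + p)%N.
  have -> : rdivp F P * P = F - rmodp F P by rewrite {2}(rdivp_eq monP F) addrK.
  rewrite (leq_trans (size_polyD _ _)) // geq_max szF size_polyN.
  have := ltn_rmodpN0 F (monic_neq0 monP); rewrite szP ltnS => /leq_trans -> //.
  exact: leq_addl.
by rewrite szqP leq_add2r leqNgt ltq.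
Qed.

Lemma size_rmodp_monic F : (size (rmodp F P) <= p)%N.
Proof. by have := ltn_rmodpN0 F (monic_neq0 monP); rewrite szP ltnS. Qed.

(* The Sylvester matrix of P and 1 is the matrix of the basis change
   P, X P, ..., X^(q-1) P, 1, ..., X^(p-1); division by P inverts it. *)
Lemma det_sylvester1_unit q : {e | e * \det (sylvester p q P 1) = 1}.
Proof.
exists (\det (row_mx (\matrix_(k < q + p) (poly_rV (rdivp 'X^k P) : 'rV_q))
                     (\matrix_(k < q + p) (poly_rV (rmodp 'X^k P) : 'rV_p)))).
rewrite -det_mulmx (_ : _ *m _ = 1%:M) ?det1 //; apply/row_matrixP => k.
rewrite row_mul row_row_mx !rowK mul_sylvester !poly_rV_K ?size_rmodp_monic //; last first.
  by rewrite size_rdivp_monic // size_polyXn.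
rewrite mulr1 -rdivp_eq // row1; apply/rowP => j; rewrite !mxE coefXn eqxx //=.
Qed.

(** Division by [P] writes each ['X^i * Q] as a multiple of [P] plus a remainder, and the remainders
    are the rows of multiplication by [Q]. This factors the Sylvester matrix through a block
    triangular one. *)
Lemma det_sylvester_monic q Q : (size Q <= q.+1)%N ->
  \det (sylvester p q P Q) = \det (horner_mx comp_mx Q) * \det (sylvester p q P 1).
Proof.
move=> szQ.
have -> : sylvester p q P Q =
   block_mx 1%:M 0 (\matrix_(i < p) poly_rV (rdivp ('X^i * Q) P)) (horner_mx comp_mx Q)
     *m sylvester p q P 1.
  rewrite mul_block_col mul1mx mul0mx addr0; congr col_mx.
  apply/row_matrixP => i; rewrite linearD /= !row_mul rowK [in LHS]rowE !mul_rV_lin1 /=.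
  rewrite rVpoly_delta [in LHS](rdivp_eq monP ('X^i * Q)) linearD /=.
  rewrite poly_rV_K ?size_rdivp_monic //; last first.
    rewrite addnC (leq_trans (size_mul_le (d := i) (e := q) _ _)) ?size_polyXn //.
    by rewrite -addSn leq_add2r.
  congr (_ + _); rewrite rowE -delta_comp_mx_exp -mulmxA.
  have -> : comp_mx ^+ i = horner_mx comp_mx 'X^i by rewrite rmorphXn /= horner_mx_X.
  have hX : horner_mx comp_mx ('X^i * Q) = horner_mx comp_mx (rmodp ('X^i * Q) P).
    rewrite {1}(rdivp_eq monP ('X^i * Q)) rmorphD [X in X + _]rmorphM.
    by rewrite /= horner_comp_mx0 mulr0 add0r.
  rewrite mulmxE -rmorphM /= hX delta_horner_comp ?size_rmodp_monic //.
  by rewrite mulr1 poly_rV_K ?size_rmodp_monic.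
by rewrite det_mulmx det_lblock det1 mul1r.
Qed.
End Companion.

(** * Splitting the norm modulo [t^N] *)

Section Congruence.
Variables (A : comNzRingType) (d : A).
Implicit Types a b : A.

Definition congr_mod a b := exists c, a = b + d * c.

Lemma congr_mod_refl a : congr_mod a a.
Proof. by exists 0; rewrite mulr0 addr0. Qed.

Lemma congr_modD a b a' b' : congr_mod a b -> congr_mod a' b' -> congr_mod (a + a') (b + b').
Proof. by move=> [c ->] [c' ->]; exists (c + c'); ring. Qed.

Lemma congr_modM a b a' b' : congr_mod a b -> congr_mod a' b' -> congr_mod (a * a') (b * b').
Proof. by move=> [c ->] [c' ->]; exists (b * c' + b' * c + d * c * c'); ring. Qed.

Lemma congr_mod_trans a b c : congr_mod a b -> congr_mod b c -> congr_mod a c.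
Proof. by move=> [x ->] [y ->]; exists (x + y); ring. Qed.

Lemma congr_mod_det n (M M' : 'M[A]_n) :
  (forall i j, congr_mod (M i j) (M' i j)) -> congr_mod (\det M) (\det M').
Proof.
move=> congM; apply: (big_ind2 congr_mod); [exact: congr_mod_refl|exact: congr_modD|].
move=> s _; apply: congr_modM; first exact: congr_mod_refl.
by apply: (big_ind2 congr_mod); [exact: congr_mod_refl|exact: congr_modM|].
Qed.
End Congruence.

Lemma sylvesterE (A : nzRingType) p q (P Q : {poly A}) (i j : 'I_(q + p)) :
  let S_ (r : {poly A}) k := r`_(j - k) *+ (k <= j)%N in
  sylvester p q P Q i j = match split i with inl k => S_ P k | inr k => S_ Q k end.
Proof.
move=> S_ /[1!mxE]; case: {i}(split i) => i /[!mxE]/=;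
  by rewrite rVpoly_delta coefXnM ltnNge if_neg -mulrb.
Qed.

Lemma congr_mod_det_sylvester (A : comNzRingType) (d : A) p q (P P' Q : {poly A}) :
  (forall i, congr_mod d P`_i P'`_i) ->
  congr_mod d (\det (sylvester p q P Q)) (\det (sylvester p q P' Q)).
Proof.
move=> congP; apply: congr_mod_det => i j; rewrite !sylvesterE; case: (split i) => k /=.
  case: (k <= j)%N => /=; [exact: congP | exact: congr_mod_refl].
exact: congr_mod_refl.
Qed.

Lemma det_sylvesterZl (A : comNzRingType) c p q (P Q : {poly A}) :
  \det (sylvester p q (c *: P) Q) = c ^+ q * \det (sylvester p q P Q).
Proof.
have -> : sylvester p q (c *: P) Q = block_mx c%:M 0 0 1%:M *m sylvester p q P Q.
  rewrite mul_block_col mul1mx !mul0mx addr0 add0r; congr col_mx.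
  by apply/matrixP => i j; rewrite mul_scalar_mx !mxE /= -scalerAr coefZ.
by rewrite det_mulmx det_ublock det_scalar det1 mulr1.
Qed.

Section TruncatedInverse.
Variable K : fieldType.
Implicit Types c : {poly K}.

(** Truncated geometric series for the inverse of [c]. Its only division is by [c.[0]], so it
    inherits continuity in the coefficients of [c]. *)
Definition tinv N c : {poly K} := (c.[0]^-1)%:P * \sum_(j < N) (1 - (c.[0]^-1)%:P * c) ^+ j.

Lemma dvdX_coef0 c : c.[0] = 0 -> exists c', c = 'X * c'.
Proof.
move=> c0; exists (drop_poly 1 c); rewrite -{1}(poly_take_drop 1 c) mulrC.
rewrite (_ : take_poly 1 c = 0) ?add0r ?expr1 //.
by apply/polyP => -[|i]; rewrite coef_take_poly coef0 // -horner_coef0.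
Qed.

Lemma tinvP N c : c.[0] != 0 -> congr_mod ('X^N) (tinv N c * c) 1.
Proof.
move=> c0; set x := 1 - (c.[0]^-1)%:P * c.
have [y xE] : exists y, x = 'X * y.
  by apply: dvdX_coef0; rewrite /x !hornerE mulVf ?subrr.
exists (- y ^+ N).
have -> : tinv N c * c = - ((x - 1) * (\sum_(j < N) x ^+ j)).
  by rewrite /tinv -/x [in RHS]/x; ring.
by rewrite -subrX1 xE exprMn; ring.
Qed.

Lemma tinv0 N c : (0 < N)%N -> c.[0] != 0 -> (tinv N c).[0] = c.[0]^-1.
Proof.
case: N => // N _ c0; rewrite /tinv hornerM hornerC horner_sum big_ord_recl big1 ?addr0.
  by rewrite expr0 hornerC mulr1.
by move=> i _; rewrite horner_exp !hornerE mulVf // subrr expr0n.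
Qed.
End TruncatedInverse.

Section CompanionField.
Variables (K : fieldType) (p' : nat).
Local Notation p := p'.+1.
Variable P : {poly K}.
Hypotheses (monP : P \is monic) (szP : size P = p.+1).
Implicit Types H : {poly K}.

(** Evaluating a Bezout relation at the companion matrix kills the multiple of [P] and exhibits an
    inverse of the action of [H], up to a nonzero constant. *)
Lemma det_horner_comp_neq0 H : coprimep P H -> \det (horner_mx (comp_mx p' P) H) != 0.
Proof.
move=> /Bezout_coprimepP[[u v] /= ]; rewrite -size_poly_eq1 => /size_poly1P[c c0 E].
have : horner_mx (comp_mx p' P) (u * P + v * H) = c%:M by rewrite E horner_mx_C.
rewrite rmorphD !rmorphM /= horner_comp_mx0 // mulr0 add0r -mulmxE => /(congr1 determinant).
rewrite det_mulmx det_scalar; apply: contra_eq_neq => ->.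
by rewrite mulr0 eq_sym expf_eq0 /= .
Qed.

(** Let [G] be the cofactor of ['X - a] in [P]. Then [H * G] is a multiple of [P], so an invertible
    action of [H] would force [G] to act as zero. This is impossible for a nonzero [G] of degree
    below [p]. *)
Lemma det_horner_comp_eq0 H a : root P a -> root H a -> \det (horner_mx (comp_mx p' P) H) = 0.
Proof.
move=> /factor_theorem[G PE] /factor_theorem[J HE]; apply/eqP/negPn/negP => nz.
have uH : horner_mx (comp_mx p' P) H \in unitmx by rewrite unitmxE unitfE.
have /(congr1 (mulmx (invmx (horner_mx (comp_mx p' P) H)))) :
    horner_mx (comp_mx p' P) H *m horner_mx (comp_mx p' P) G = 0.
  rewrite mulmxE -rmorphM HE (_ : _ * G = J * P); last by rewrite PE; ring.
  by rewrite rmorphM /= horner_comp_mx0 // mulr0.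
rewrite mulKmx // mulmx0 => G0.
have Gn0 : G != 0 by apply: contraTneq (monic_neq0 monP) => G0'; rewrite PE G0' mul0r eqxx.
have szG : size G = p.
  by move: szP; rewrite PE size_Mmonic ?monicXsubC // size_XsubC addn2 /= => -[].
have /rowP r0 : poly_rV G = 0 :> 'rV_p.
  by rewrite -(@delta_horner_comp _ _ P) ?szG // G0 mulmx0.
move: Gn0; rewrite -lead_coef_eq0 /lead_coef szG /=; have := r0 ord_max.
by rewrite !mxE /= => ->; rewrite eqxx.
Qed.
End CompanionField.

(** * Factoring the norm into the part over a root and the part away from it *)

Section Splitting.
Variables (K : fieldType) (p' q m N : nat).
Local Notation p := p'.+1.
Implicit Types (P Q : {poly {poly K}}) (G F E H : {poly K}) (a : K).

(** Division of [P] by its coefficient of degree [p], with the top coefficient set to exactly 1: the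
    result is monic, at the price of agreeing with that quotient only modulo [t^N]. *)
Definition monicize P : {poly {poly K}} :=
  'X^p + \poly_(i < p) (tinv N P`_p * P`_i).

(* Up to the factor G(a)^(N m N), which avoids a division, [far_idem] is 0
   modulo (X - a)^(m N) and 1 modulo G^N, and [near_idem] is complementary. *)
Definition far_idem G a : {poly K} := ((G.[a] ^+ N)%:P - G ^+ N) ^+ (m * N).
Definition near_idem G a : {poly K} := ((G.[a] ^+ N) ^+ (m * N))%:P - far_idem G a.

(* With E and F complementary idempotents, this is Q on the part cut out by E
   and 1 on the other one; [polyC] makes E and F constant in t. *)
Definition mix Q E F : {poly {poly K}} := Q * map_poly polyC E + map_poly polyC F.
(** The norm of the class of [H] modulo [monicize P], as the determinant of multiplication by
    [H]. *)
Definition norm_mod P (H : {poly {poly K}}) : {poly K} := \det (horner_mx (comp_mx p' (monicize P)) H).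
Definition near_factor P Q G a := norm_mod P (mix Q (near_idem G a) (far_idem G a)).
Definition far_factor P Q G a := norm_mod P (mix Q (far_idem G a) (near_idem G a)).

Lemma coef_monicize P i :
  (monicize P)`_i = if (i < p)%N then tinv N P`_p * P`_i else (i == p)%:R.
Proof.
rewrite coefD coefXn coef_poly; case: ltnP => [ltip|]; last by rewrite addr0.
by rewrite ltn_eqF // add0r.
Qed.

Lemma size_monicize P : size (monicize P) = p.+1.
Proof.
by rewrite /monicize size_polyDl ?size_polyXn // ltnS size_poly.
Qed.

Lemma monic_monicize P : monicize P \is monic.
Proof. by rewrite monicE /lead_coef size_monicize coef_monicize ltnn eqxx. Qed.

Variables (P Q : {poly {poly K}}) (G : {poly K}) (a : K).
Hypotheses (szP : (size P <= p.+1)%N) (szQ : (size Q <= q.+1)%N) (N_gt0 : (0 < N)%N).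
Hypotheses (lc0 : (P`_p).[0] != 0).
Let P0 : {poly K} := map_poly (horner_eval 0) P.
Hypotheses (P0E : P0 = ('X - a%:P) ^+ m * G) (Ga : G.[a] != 0).

Lemma monicize_at0 : map_poly (horner_eval 0) (monicize P) = ((P`_p).[0])^-1 *: P0.
Proof.
apply/polyP => i; rewrite coefZ !coef_map /= coef_monicize /horner_eval.
case: ltngtP => [ltip|gtip|->]; last by rewrite hornerE mulVf.
  by rewrite hornerM tinv0.
by rewrite (nth_default _ (leq_trans szP gtip)) !horner0 mulr0.
Qed.

(** With [g] the constant [G.[a] ^+ N], this is a difference of equal powers of [g] and
    [g - G ^+ N], hence a multiple of [G ^+ N]. *)
Lemma near_idem_dvd : exists J, near_idem G a = G ^+ N * J.
Proof.
rewrite /near_idem /far_idem polyC_exp; set g := (G.[a] ^+ N)%:P.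
rewrite subrXX; exists (\sum_(i < m * N) g ^+ ((m * N).-1 - i) * (g - G ^+ N) ^+ i).
by rewrite opprB addrC subrK.
Qed.

(** The base of the power vanishes at [a], and the exponent is [m * N]. *)
Lemma far_idem_dvd : exists J, far_idem G a = (('X - a%:P) ^+ m) ^+ N * J.
Proof.
have /factor_theorem[J JE] : root ((G.[a] ^+ N)%:P - G ^+ N) a.
  by rewrite /root hornerD hornerN hornerC horner_exp subrr.
by exists (J ^+ (m * N)); rewrite /far_idem JE exprMn mulrC exprM.
Qed.

Lemma idem_sum : near_idem G a + far_idem G a = ((G.[a] ^+ N) ^+ (m * N))%:P.
Proof. by rewrite /near_idem subrK. Qed.

(** Seen as constant in [t], [P0] agrees at [t = 0] with a multiple of [monicize P], which acts as
    zero. So [P0] acts as a multiple of [t], and [P0 ^+ N] as zero modulo [t^N]. *)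
Lemma horner_comp_P0 : exists Z,
  horner_mx (comp_mx p' (monicize P)) (map_poly polyC P0) = 'X *: Z.
Proof.
set M := comp_mx _ _; set c := (P`_p).[0].
pose D := map_poly polyC P0 - c%:P *: monicize P.
have Di i : exists y, D`_i = 'X * y.
  apply: dvdX_coef0; rewrite /D coefB coefZ hornerD hornerN hornerM hornerC coef_map hornerC.
  have := congr1 (fun f : {poly K} => f`_i) monicize_at0.
  rewrite coefZ coef_map /= /horner_eval => ->; rewrite -/c.
  by rewrite mulrA divff // mul1r subrr.
exists (horner_mx M (\poly_(i < size D) (drop_poly 1 D`_i))).
have -> : map_poly polyC P0 = D + c%:P *: monicize P by rewrite /D subrK.
rewrite rmorphD /= horner_mxZ horner_comp_mx0 ?size_monicize ?monic_monicize // scaler0 addr0.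
rewrite -horner_mxZ; congr horner_mx; apply/polyP => i; rewrite coefZ coef_poly.
case: ltnP => [_|ge]; last by rewrite nth_default ?mulr0.
by have [y ->] := Di i; rewrite [_ * y]mulrC -['X]expr1 drop_polyMXn_id mulrC.
Qed.

(** The product of the two idempotents is a multiple of [P0 ^+ N], which acts as zero modulo [t^N].
    So the two mixed elements multiply to a scalar times [Q], whose norm is the resultant up to a
    unit. *)
Lemma near_far_factor : exists2 W : {poly K}, W.[0] != 0 &
  congr_mod ('X^N) (near_factor P Q G a * far_factor P Q G a) (W * \det (sylvester p q P Q)).
Proof.
set s := (G.[a] ^+ N) ^+ (m * N); have s0 : s != 0 by rewrite !expf_neq0.
set M := comp_mx p' (monicize P).
have [e eP] := det_sylvester1_unit (monic_monicize P) (size_monicize P) q.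
(* The factors come from the scalar [s ^+ 2] in a determinant of size [p], from inverting the
   Sylvester determinant of [monicize P] and 1, and from normalizing the [q] rows built from [P]. *)
exists ((s ^+ 2 ^+ p)%:P * e * tinv N P`_p ^+ q).
  rewrite !hornerM hornerC horner_exp tinv0 // !mulf_neq0 ?expf_neq0 ?invr_neq0 //.
  apply: contra_eq_neq (congr1 (horner^~ 0) eP) => e0.
  by rewrite hornerM e0 mul0r hornerC eq_sym oner_neq0.
have [J JE] := near_idem_dvd; have [J' J'E] := far_idem_dvd; have [Z ZE] := horner_comp_P0.
have EF : near_idem G a * far_idem G a = P0 ^+ N * (J * J').
  by rewrite JE J'E P0E exprMn; ring.
rewrite /near_factor /far_factor /norm_mod -/M -det_mulmx mulmxE -rmorphM.
(* If [x + y = s], then [(Q x + y) (Q y + x) = s^2 Q + x y (Q - 1)^2]. *)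
have mixE : mix Q (near_idem G a) (far_idem G a) * mix Q (far_idem G a) (near_idem G a) =
    (s ^+ 2)%:P *: Q + map_poly polyC P0 ^+ N * (map_poly polyC (J * J') * (Q - 1) ^+ 2).
  rewrite mulrA -rmorphXn -rmorphM -EF rmorphM /=.
  have : map_poly polyC (near_idem G a) + map_poly polyC (far_idem G a) = s%:P%:P.
    by rewrite -rmorphD idem_sum /= map_polyC.
  rewrite /mix; set x := map_poly polyC (near_idem G a); set y := map_poly _ _ => xy.
  rewrite -mul_polyC polyC_exp polyC_exp -xy; ring.
rewrite mixE rmorphD /= horner_mxZ [in X in _ + X]rmorphM [in X in _ + X]rmorphXn /= ZE.
apply: congr_mod_trans (congr_mod_det (M' := (s ^+ 2)%:P *: horner_mx M Q) _) _ => [i j|].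
  rewrite exprZn -scalerAl [in X in congr_mod _ X]mxE.
  by rewrite [in X in congr_mod _ (_ + X)]mxE; eexists; reflexivity.
rewrite detZ -polyC_exp -!mulrA; apply: congr_modM; first exact: congr_mod_refl.
have -> : \det (horner_mx M Q) = e * \det (sylvester p q (monicize P) Q).
  by rewrite (det_sylvester_monic (monic_monicize P) (size_monicize P)) // mulrCA eP mulr1.
apply: congr_modM; first exact: congr_mod_refl.
rewrite -det_sylvesterZl; apply: congr_mod_det_sylvester => i; rewrite coefZ coef_monicize.
case: ltngtP => [_|gtip|->]; first exact: congr_mod_refl.
  by rewrite (nth_default _ (leq_trans szP gtip)) mulr0; exact: congr_mod_refl.
have [c cE] := tinvP N lc0; exists (- c); by rewrite cE mulrN addrK.
Qed.

Hypothesis m_gt0 : (0 < m)%N.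

(** At [t = 0] this factor is the norm of [H], which takes at [a] the value of [Q0] times a nonzero
    constant and is a nonzero constant modulo [G]. So [H] is coprime to [P0] exactly when [Q0] does
    not vanish at [a]. *)
Lemma near_factor0 : ((near_factor P Q G a).[0] == 0) = root (map_poly (horner_eval 0) Q) a.
Proof.
set P1 := ((P`_p).[0])^-1 *: P0; set Q0 := map_poly _ Q.
pose H := Q0 * near_idem G a + far_idem G a.
have szP1 : size P1 = p.+1.
  by rewrite /P1 -monicize_at0 size_map_poly_id0 ?size_monicize //
    (eqP (monic_monicize P)) /horner_eval hornerE oner_neq0.
have monP1 : P1 \is monic by rewrite /P1 -monicize_at0 monic_map ?monic_monicize.
have -> : (near_factor P Q G a).[0] = \det (horner_mx (comp_mx p' P1) H).
  rewrite -[LHS]/(horner_eval 0 _) -det_map_mx map_horner_mx; congr (\det (horner_mx _ _)).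
    apply/matrixP => i j; rewrite !mxE /P1 -monicize_at0 coef_map.
    by case: ifP => _; rewrite ?rmorphN //= rmorph_nat.
  rewrite /mix rmorphD rmorphM /= -!map_poly_comp /H.
  by congr (_ * _ + _); rewrite map_poly_id // => x _; rewrite /= /horner_eval hornerC.
have s0 : (G.[a] ^+ N) ^+ (m * N) != 0 by rewrite !expf_neq0.
have far_a : (far_idem G a).[a] = 0.
  rewrite /far_idem horner_exp hornerD hornerN hornerC horner_exp subrr expr0n muln_eq0.
  by rewrite -!leqn0 leqNgt m_gt0 leqNgt N_gt0.
have near_a : (near_idem G a).[a] = (G.[a] ^+ N) ^+ (m * N).
  by rewrite hornerD hornerN hornerC far_a subr0.
have Ha : H.[a] = Q0.[a] * (G.[a] ^+ N) ^+ (m * N).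
  by rewrite hornerD hornerM far_a near_a addr0.
apply/idP/idP => [|rQ]; last first.
  apply/eqP/(det_horner_comp_eq0 monP1 szP1 (a := a)); last by rewrite /root Ha (eqP rQ) mul0r.
  by rewrite /P1 P0E /root hornerZ hornerM horner_exp hornerXsubC subrr expr0n gtn_eqF // mul0r mulr0.
apply: contraTT => nrQ; apply: det_horner_comp_neq0 => //.
rewrite /P1 coprimepZl ?invr_eq0 // P0E coprimepMl; apply/andP; split.
  by rewrite coprimep_pexpl // coprimep_sym coprimep_XsubC /root Ha mulf_neq0.
have [J JE] := near_idem_dvd.
have -> : H = (Q0 - 1) * G ^+ N.-1 * J * G + ((G.[a] ^+ N) ^+ (m * N))%:P.
  have GN : G ^+ N = G * G ^+ N.-1 by rewrite -exprS prednK.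
  by rewrite -idem_sum /H JE GN; ring.
by rewrite coprimep_addl_mul -[_%:P]mulr1 mul_polyC coprimepZr // coprimep1.
Qed.
End Splitting.

(** * Orders along lines *)

Lemma rmorph_mmap (n : nat) (R : nzRingType) (S T : comNzRingType) (g : {rmorphism S -> T})
    (f : R -> S) (h : 'I_n -> S) (f' : R -> T) (h' : 'I_n -> T) (p : {mpoly R[n]}) :
  (forall c, g (f c) = f' c) -> (forall i, g (h i) = h' i) ->
  g (mmap f h p) = mmap f' h' p.
Proof.
move=> ff' hh'; rewrite /mmap rmorph_sum; apply: eq_bigr => u _.
rewrite rmorphM ff' /mmap1 rmorph_prod; congr (_ * _).
by apply: eq_bigr => i _; rewrite rmorphXn hh'.
Qed.

Lemma poly_eq0_forall (R : numDomainType) (p : {poly R}) : (forall t, p.[t] = 0) -> p = 0.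
Proof.
move=> p0; apply/eqP/negPn/negP => nz.
suff : (size [seq i%:R : R | i <- iota 0 (size p)] < size p)%N by rewrite size_map size_iota ltnn.
apply: max_poly_roots => //; first by apply/allP => t _; apply/eqP.
by rewrite map_inj_uniq ?iota_uniq //; apply: mulrIn; rewrite oner_neq0.
Qed.

Section Line.
Variables (n : nat) (R : comNzRingType) (B : comNzRingType) (iota : {rmorphism R -> B}).

(** Restriction to the line through [a] with direction [b]. The ring [B] may extend [R], so that [a]
    and [b] can contain a further indeterminate. *)
Definition line (a b : 'I_n -> B) : {mpoly R[n]} -> {poly B} :=
  mmap (polyC \o iota) (fun j => (a j)%:P + b j *: 'X).

HB.instance Definition _ a b := GRing.RMorphism.on (line a b).

(** Chain rule: the identity is stable under sums and products and holds for constants and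
    variables. *)
Lemma deriv_line a b p : (line a b p)^`() = \sum_j b j *: line a b (p^`M(j)).
Proof.
pose D (p : {mpoly R[n]}) := (line a b p)^`() = \sum_j b j *: line a b (p^`M(j)).
rewrite -/(D p).
have DD p1 p2 : D p1 -> D p2 -> D (p1 + p2).
  rewrite /D => D1 D2; rewrite rmorphD derivD D1 D2 -big_split; apply: eq_bigr => j _.
  by rewrite linearD rmorphD scalerDr.
have DM p1 p2 : D p1 -> D p2 -> D (p1 * p2).
  rewrite /D => D1 D2; rewrite rmorphM derivM D1 D2 mulr_suml mulr_sumr -big_split.
  apply: eq_bigr => j _.
  by rewrite mderivM rmorphD !rmorphM scalerDr -scalerAl -scalerAr.
have DC c : D c%:MP.
  rewrite /D /line mmapC derivC big1 // => j _.
  by rewrite mderivC raddf0 scaler0.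
have DX i : D 'X_i.
  rewrite /D /line mmapX mmap1U derivD derivC add0r derivZ derivX.
  rewrite (bigD1 i) //= big1 ?addr0 => [|j /negPf neji].
    rewrite mderivX mnm1E eqxx scale1r (_ : (U_(i) - U_(i))%MM = 0%MM) ?mpolyX0 ?rmorph1 //.
    by apply/mnmP => l; rewrite mnmBE subnn mnm0E.
  by rewrite mderivX mnm1E eq_sym neji scale0r rmorph0 scaler0.
rewrite [p]mpolyE; apply: (big_ind D) => [||u _]; [exact: (DC 0)|exact: DD|].
rewrite -mul_mpolyC; apply: (DM); first exact: DC.
rewrite mpolyXE_id; apply: (big_ind D) => [||i _]; [exact: (DC 1)|exact: DM|].
elim: (u i) => [|k IH]; first exact: (DC 1).
by rewrite exprS; apply: (DM).
Qed.

Lemma line_at0 a b p : (line a b p).[0] = mmap iota a p.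
Proof.
rewrite -[LHS]/(horner_eval 0 _) /line; apply: rmorph_mmap => [c|i] /=.
  by rewrite /horner_eval hornerC.
by rewrite /horner_eval !hornerE.
Qed.
End Line.

Section OrderAlongLine.
Variables (R : realType) (n : nat).
Implicit Types (f : {mpoly R[n]}) (x d : pt R n).

Local Notation rline := (line (B := R) idfun).

(** Induction on [j] by the chain rule: each derivative in [t] uses up one order of partial
    derivation, and [j.+1] can be cancelled in [R]. *)
Lemma coef_line_lt k f x d : (forall s, (size s < k)%N -> (mderivs s f).@[x] = 0) ->
  forall j, (j < k)%N -> (rline x d f)`_j = 0.
Proof.
move=> f0 j; elim: j k f f0 => [|j IH] k f f0 ltjk.
  by rewrite -horner_coef0 line_at0; exact: (f0 [::]).
suff /eqP : (rline x d f)`_j.+1 *+ j.+1 = 0 by rewrite mulrn_eq0 => /eqP.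
rewrite -coef_deriv deriv_line coef_sum big1 // => i _.
rewrite coefZ (IH k.-1) ?mulr0 // => [s szs|]; last by rewrite -ltnS (ltn_predK ltjk).
have := f0 (rcons s i); rewrite /mderivs foldr_rcons => -> //.
by rewrite size_rcons -(ltn_predK ltjk) ltnS.
Qed.

(* Perturb the direction d by s e_i: the t^(k+1)-coefficient is a polynomial
   in s that vanishes identically, and its s-coefficient is the claim. *)
Lemma coef_line_mderiv k f x i :
  (forall d, (rline x d f)`_k.+1 = 0) -> forall d, (rline x d f^`M(i))`_k = 0.
Proof.
move=> f0 d; pose a j : {poly R} := (x j)%:P + d j *: 'X.
pose b j : {poly R} := if j == i then 'X else 0.
pose sg := line polyC a b.
have sgt t : (sg f).[t%:P] = rline x (fun j => d j + (if j == i then t else 0)) f.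
  rewrite -[LHS]/(horner_eval t%:P _) /sg /line; apply: rmorph_mmap => [c|j] /=.
    by rewrite /horner_eval hornerC.
  rewrite /horner_eval /a /b !hornerE scalerDl -!mul_polyC; case: ifP => _.
    by ring.
  by rewrite polyC0; ring.
have pz : \poly_(j < size (sg f)) ((sg f)`_j)`_k.+1 = 0.
  apply: poly_eq0_forall => t; have := f0 (fun j => d j + (if j == i then t else 0)).
  rewrite -sgt horner_coef coef_sum; apply: etrans; rewrite horner_poly; apply: eq_bigr => j _.
  by rewrite -polyC_exp coefMC.
have sg1 : ((sg f)`_1)`_k.+1 = 0.
  have := congr1 (fun p : {poly R} => p`_1) pz; rewrite coef_poly coef0.
  by case: ltnP => // le _; rewrite [(sg f)`_1]nth_default // coef0.
(* The term linear in [s] is [t] times the restriction of the [i]-th partial derivative; the factor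
   [t] shifts degree [k] to [k.+1]. *)
have sgE : (sg f)`_1 = \sum_j b j * (sg f^`M(j))`_0.
  rewrite -[LHS]mulr1n -coef_deriv deriv_line coef_sum; apply: eq_bigr => j _.
  by rewrite coefZ.
move: sg1; rewrite sgE (bigD1 i) //= big1 ?addr0 => [|j /negPf neji]; last first.
  by rewrite /b neji mul0r.
by rewrite /b eqxx coefXM /= -horner_coef0 line_at0.
Qed.

(** [coef_line_mderiv] passes the hypothesis to partial derivatives while lowering [k]; for [k = 0]
    the coefficient is the value at [x]. *)
Lemma mderivs_of_line k f x :
  (forall d, (rline x d f)`_k = 0) -> forall s, size s = k -> (mderivs s f).@[x] = 0.
Proof.
elim: k f => [|k IH] f f0 s.
  by move=> /size0nil ->; rewrite -(f0 x) -horner_coef0 line_at0.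
case/lastP: s => // s i; rewrite size_rcons /mderivs foldr_rcons => -[].
by apply: IH; exact: coef_line_mderiv.
Qed.

Lemma ord_is_line k f x : ord_is f x k -> exists d, (rline x d f)`_k != 0.
Proof.
move=> [_ [s [szs nz]]]; apply: contrapT => /forallNP none; move/eqP: nz; apply.
by apply: mderivs_of_line szs => d; apply/eqP/negPn/negP; exact: none.
Qed.
End OrderAlongLine.

(** * Families with continuous coefficients *)

(** Isolating the closure properties lets continuity at a point be lifted uniformly to polynomials,
    to polynomials over those, and to matrices and determinants. *)
Record subring_family (X : Type) (B : nzRingType) (C : (X -> B) -> Prop) : Prop := {
  family_cst : forall c, C (fun=> c);
  familyD : forall f g, C f -> C g -> C (fun x => f x + g x);
  familyM : forall f g, C f -> C g -> C (fun x => f x * g x) }.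

Section SubringFamily.
Variables (X : Type) (B : nzRingType) (C : (X -> B) -> Prop).
Hypothesis CF : subring_family C.

Lemma familyN f : C f -> C (fun x => - f x).
Proof.
move=> Cf; rewrite (_ : (fun x => _) = fun x => -1 * f x); last by apply: funext => x; rewrite mulN1r.
by apply: familyM => //; exact: family_cst.
Qed.

Lemma familyB f g : C f -> C g -> C (fun x => f x - g x).
Proof. by move=> Cf Cg; apply: familyD => //; exact: familyN. Qed.

Lemma family_sum I (r : seq I) (h : I -> X -> B) :
  (forall i, C (h i)) -> C (fun x => \sum_(i <- r) h i x).
Proof.
move=> Ch; elim: r => [|i r IH].
  rewrite (_ : (fun x => _) = fun=> 0); first exact: family_cst.
  by apply: funext => x; rewrite big_nil.
rewrite (_ : (fun x => _) = fun x => h i x + \sum_(i <- r) h i x); first exact: familyD.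
by apply: funext => x; rewrite big_cons.
Qed.

Lemma family_prod I (r : seq I) (h : I -> X -> B) :
  (forall i, C (h i)) -> C (fun x => \prod_(i <- r) h i x).
Proof.
move=> Ch; elim: r => [|i r IH].
  rewrite (_ : (fun x => _) = fun=> 1); first exact: family_cst.
  by apply: funext => x; rewrite big_nil.
rewrite (_ : (fun x => _) = fun x => h i x * \prod_(i <- r) h i x); first exact: familyM.
by apply: funext => x; rewrite big_cons.
Qed.

Lemma familyX n f : C f -> C (fun x => f x ^+ n).
Proof.
move=> Cf; rewrite (_ : (fun x => _) = fun x => \prod_(i < n) f x); first exact: family_prod.
by apply: funext => x; rewrite prodr_const card_ord.
Qed.
End SubringFamily.

Section PolyFamily.
Variables (X : Type) (B : nzRingType) (C : (X -> B) -> Prop).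
Hypothesis CF : subring_family C.

(** The uniform size bound turns evaluation and composition into sums of fixed length. *)
Definition poly_family (F : X -> {poly B}) : Prop :=
  (exists n, forall x, (size (F x) <= n)%N) /\ forall i, C (fun x => (F x)`_i).

Lemma poly_family_subring : subring_family poly_family.
Proof.
split=> [c|F G [[n Fn] CFi] [[k Gk] CGi]|F G [[n Fn] CFi] [[k Gk] CGi]]; split.
- by exists (size c).
- by move=> i; exact: family_cst.
- exists (maxn n k) => x; rewrite (leq_trans (size_polyD _ _)) // geq_max.
  by rewrite !leq_max Fn Gk orbT.
- move=> i; rewrite (_ : (fun x => _) = fun x => (F x)`_i + (G x)`_i); first exact: familyD.
  by apply: funext => x; rewrite coefD.
- exists (n + k)%N => x; rewrite (leq_trans (size_polyMleq _ _)) //.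
  by rewrite (leq_trans (leq_pred _)) // leq_add.
- move=> i.
  rewrite (_ : (fun x => _) = fun x => \sum_(j < i.+1) (F x)`_j * (G x)`_(i - j)).
    by apply: family_sum => // j; apply: familyM.
  by apply: funext => x; rewrite coefM.
Qed.
Let PF := poly_family_subring.

Lemma poly_familyC f : C f -> poly_family (fun x => (f x)%:P).
Proof.
move=> Cf; split=> [|[|i]]; first by exists 1 => x; exact: size_polyC_leq1.
  by rewrite (_ : (fun x => _) = f) //; apply: funext => x; rewrite coefC eqxx.
rewrite (_ : (fun x => _) = fun=> 0); first exact: family_cst.
by apply: funext => x; rewrite coefC.
Qed.

Lemma poly_family_poly n (h : X -> nat -> B) : (forall i, C (fun x => h x i)) ->
  poly_family (fun x => \poly_(i < n) h x i).
Proof.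
move=> Ch; split=> [|i]; first by exists n => x; exact: size_poly.
have [ltin|leni] := ltnP i n.
  rewrite (_ : (fun x => _) = fun x => h x i) //.
  by apply: funext => x; rewrite coef_poly ltin.
rewrite (_ : (fun x => _) = fun=> 0); first exact: family_cst.
by apply: funext => x; rewrite coef_poly ltnNge leni.
Qed.

Lemma poly_family_drop k F : poly_family F -> poly_family (fun x => drop_poly k (F x)).
Proof.
move=> [[n Fn] CFi]; split=> [|i].
  by exists n => x; rewrite size_drop_poly (leq_trans (leq_subr _ _)).
rewrite (_ : (fun x => _) = fun x => (F x)`_(i + k)) //.
by apply: funext => x; rewrite coef_drop_poly.
Qed.

Lemma family_horner F f : poly_family F -> C f -> C (fun x => (F x).[f x]).
Proof.
move=> [[n Fn] CFi] Cf.
rewrite (_ : (fun x => _) = fun x => \sum_(i < n) (F x)`_i * f x ^+ i).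
  by apply: family_sum => // i; apply: familyM => //; exact: familyX.
by apply: funext => x; rewrite (horner_coef_wide _ (Fn x)).
Qed.

Lemma poly_family_comp F G : poly_family F -> poly_family G ->
  poly_family (fun x => F x \Po G x).
Proof.
move=> [[n Fn] CFi] CG.
rewrite (_ : (fun x => _) = fun x => \sum_(i < n) ((F x)`_i)%:P * G x ^+ i).
  apply: family_sum => // i; apply: familyM => //; first exact: poly_familyC.
  exact: familyX.
apply: funext => x; rewrite comp_polyE (big_ord_widen n (fun i => (F x)`_i *: G x ^+ i)) //.
rewrite big_mkcond; apply: eq_bigr => i _; rewrite mul_polyC.
by case: ltnP => // le; rewrite nth_default // scale0r.
Qed.
End PolyFamily.

Section MatrixFamily.
Variables (X : Type) (B : comNzRingType) (C : (X -> B) -> Prop).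
Hypothesis CF : subring_family C.

Definition mx_family n (M : X -> 'M[B]_n) : Prop := forall i j, C (fun x => M x i j).

Lemma mx_family_subring n : subring_family (@mx_family n.+1).
Proof.
split=> [c|M N CM CN|M N CM CN] i j; first exact: family_cst.
  rewrite (_ : (fun x => _) = fun x => M x i j + N x i j); first exact: familyD.
  by apply: funext => x; rewrite mxE.
rewrite (_ : (fun x => _) = fun x => \sum_l M x i l * N x l j).
  by apply: family_sum => // l; apply: familyM.
by apply: funext => x; rewrite mxE.
Qed.

Lemma mx_family_horner n (M : X -> 'M[B]_n.+1) F : mx_family M -> poly_family C F ->
  mx_family (fun x => horner_mx (M x) (F x)).
Proof.
move=> CM [[k Fk] CFi].
rewrite (_ : (fun x => _) = fun x => \sum_(i < k) ((F x)`_i)%:M * M x ^+ i).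
  apply: (family_sum (mx_family_subring n)) => i; apply: (familyM (mx_family_subring n)).
    move=> l j; case: (eqVneq l j) => [->|neq].
      by rewrite (_ : (fun x => _) = fun x => (F x)`_i) //; apply: funext => x; rewrite mxE eqxx.
    rewrite (_ : (fun x => _) = fun=> 0); first exact: family_cst.
    by apply: funext => x; rewrite mxE (negPf neq).
  exact: (familyX (mx_family_subring n)).
apply: funext => x; rewrite {1}(poly_sum_le (Fk x)) rmorph_sum; apply: eq_bigr => i _.
by rewrite /= horner_mxZ rmorphXn /= horner_mx_X -mulmxE mul_scalar_mx.
Qed.

Lemma family_det n (M : X -> 'M[B]_n) : mx_family M -> C (fun x => \det (M x)).
Proof.
move=> CM; apply: family_sum => // s; apply: familyM => //; first exact: family_cst.
exact: family_prod.
Qed.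
End MatrixFamily.

Section ContinuousFamily.
Variables (R : realType) (n : nat) (S : pt R n -> Prop) (x0 : pt R n).
Hypothesis Sx0 : S x0.

Definition near_pt (P : pt R n -> Prop) : Prop :=
  exists2 r : R, 0 < r & forall x, S x -> inball x0 r x -> P x.

Definition cont_pt (f : pt R n -> R) : Prop :=
  forall e : R, 0 < e -> near_pt (fun x => `|f x - f x0| < e).

Lemma inball_center (r : R) : 0 < r -> inball x0 r x0.
Proof. by move=> r0 i; rewrite subrr normr0. Qed.

Lemma near_pt_and P Q : near_pt P -> near_pt Q -> near_pt (fun x => P x /\ Q x).
Proof.
move=> [r r0 Pr] [t t0 Qt]; exists (Num.min r t); first by rewrite lt_min r0.
move=> x Sx xr; split; [apply: Pr|apply: Qt] => // i; have := xr i; rewrite lt_min => /andP[] //.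
Qed.

Lemma near_pt_imp (P Q : pt R n -> Prop) : near_pt P -> (forall x, S x -> P x -> Q x) -> near_pt Q.
Proof. by move=> [r r0 Pr] PQ; exists r => // x Sx xr; apply: PQ => //; exact: Pr. Qed.

Lemma near_pt_all (P : pt R n -> Prop) : (forall x, S x -> P x) -> near_pt P.
Proof. by move=> Px; exists 1 => // x Sx _; exact: Px. Qed.

Lemma near_pt_center P : near_pt P -> P x0.
Proof. by move=> [r r0]; apply => //; exact: inball_center. Qed.

Lemma cont_pt_subring : subring_family cont_pt.
Proof.
split=> [c e e0|f g cf cg e e0|f g cf cg e e0].
- by apply: near_pt_all => x _; rewrite subrr normr0.
- have e2 : 0 < e / 2 by rewrite divr_gt0.
  apply: (near_pt_imp (near_pt_and (cf _ e2) (cg _ e2))) => x _ [fx gx].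
  have -> : f x + g x - (f x0 + g x0) = (f x - f x0) + (g x - g x0) by ring.
  by rewrite (le_lt_trans (ler_normD _ _)) // [ltRHS]splitr ltrD.
have M0 : 0 < `|f x0| + `|g x0| + 1 by rewrite ltr_wpDl // addr_ge0.
set M := (_ + 1) in M0.
(* As [t <= 1], the three terms of the expansion are at most [t], [|f x0| t] and [|g x0| t], in
   total [t M <= e / 2]. *)
pose t := Num.min 1 (e / (2 * M)).
have t0 : 0 < t by rewrite lt_min ltr01 divr_gt0 // mulr_gt0.
apply: (near_pt_imp (near_pt_and (cf _ t0) (cg _ t0))) => x _ [fx gx].
have -> : f x * g x - f x0 * g x0 =
  (f x - f x0) * (g x - g x0) + f x0 * (g x - g x0) + g x0 * (f x - f x0) by ring.
have t1 : t <= 1 by rewrite ge_min lexx.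
have tM : t * M <= e / 2.
  have tle : t <= e / (2 * M) by rewrite ge_min lexx orbT.
  rewrite (le_trans (ler_wpM2r (ltW M0) tle)) // le_eqVlt; apply/orP; left; apply/eqP.
  by field; rewrite gt_eqF.
have e2 : e / 2 < e by lra.
apply: le_lt_trans (le_lt_trans tM e2).
apply: le_trans (ler_normD _ _) _; apply: le_trans (lerD (ler_normD _ _) (lexx _)) _.
rewrite !normrM (_ : t * M = t * 1 + `|f x0| * t + `|g x0| * t); last by rewrite /M; ring.
by rewrite !lerD // ?ler_pM // ?ler_wpM2l // ltW // (lt_le_trans gx).
Qed.

Lemma cont_pt_neq0 f : cont_pt f -> f x0 != 0 -> near_pt (fun x => f x != 0).
Proof.
move=> cf f0; have n0 : 0 < `|f x0| by rewrite normr_gt0.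
apply: near_pt_imp (cf _ n0) _ => x _; apply: contraTneq => ->.
by rewrite sub0r normrN ltxx.
Qed.

Lemma cont_ptV f : cont_pt f -> f x0 != 0 -> cont_pt (fun x => (f x)^-1).
Proof.
move=> cf f0 e e0; have n0 : 0 < `|f x0| by rewrite normr_gt0.
set a := `|f x0| in n0 *.
(* The tolerance [a / 2] keeps [|f x|] above [a / 2], so the denominator of the difference of
   inverses exceeds [a (a / 2)]; the second tolerance absorbs it. *)
have a2 : 0 < a / 2 by rewrite divr_gt0.
have ea : 0 < e * (a * (a / 2)) by rewrite mulr_gt0 // mulr_gt0.
apply: near_pt_imp (near_pt_and (cf _ a2) (cf _ ea)) _ => x _ [fx1 fx2].
have fxa : a / 2 < `|f x|.
  have := ler_normB (f x) (f x - f x0); rewrite opprB addrC subrK -/a => h.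
  lra.
have fx0 : f x != 0 by rewrite -normr_gt0 (lt_trans a2).
have -> : (f x)^-1 - (f x0)^-1 = (f x0 - f x) / (f x0 * f x) by field; rewrite fx0 f0.
rewrite normrM normfV normrM -/a distrC ltr_pdivrMr ?mulr_gt0 ?normr_gt0 //.
by rewrite (lt_trans fx2) // ltr_pM2l // ltr_pM2l.
Qed.
Local Notation C1 := (poly_family cont_pt).
Local Notation C2 := (poly_family C1).
Let F0 := cont_pt_subring.
Let F1 := poly_family_subring F0.
Let F2 := poly_family_subring F1.

Lemma cont_pt_coord i : cont_pt (fun x => x i).
Proof. by move=> e e0; exists e => // x _; apply. Qed.

Lemma meval_family (c : {mpoly R[n]}) : cont_pt (fun x => c.@[x]).
Proof.
apply: (family_sum F0) => u; apply: (familyM F0); first exact: (family_cst F0).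
by apply: (family_prod F0) => i; apply: (familyX F0); exact: cont_pt_coord.
Qed.

Lemma Eval_family (P : {poly {mpoly R[n]}}) : C1 (fun x => Eval x P).
Proof.
split=> [|i]; first by exists (size P) => x; exact: size_poly.
rewrite (_ : (fun x => _) = fun x => (P`_i).@[x]); first exact: meval_family.
by apply: funext => x; rewrite coef_map.
Qed.

Lemma line_family d c : C1 (fun x => line idfun x d c).
Proof.
apply: (family_sum F1) => u; apply: (familyM F1); first exact: (family_cst F1).
apply: (family_prod F1) => i; apply: (familyX F1); apply: (familyD F1); last exact: (family_cst F1).
by apply: poly_familyC => //; exact: cont_pt_coord.
Qed.

Lemma map_line_family d (P : {poly {mpoly R[n]}}) : C2 (fun x => map_poly (line idfun x d) P).
Proof.
split=> [|i]; first by exists (size P) => x; exact: size_poly.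
rewrite (_ : (fun x => _) = fun x => line idfun x d P`_i); first exact: line_family.
by apply: funext => x; rewrite coef_map.
Qed.

Lemma tinv_family N (c : pt R n -> {poly R}) : C1 c -> (c x0).[0] != 0 ->
  C1 (fun x => tinv N (c x)).
Proof.
move=> Cc c0; have cV : C1 (fun x => ((c x).[0]^-1)%:P).
  apply: poly_familyC => //; apply: cont_ptV => //.
  exact: (family_horner F0 Cc (family_cst F0 0)).
apply: (familyM F1) => //; apply: (family_sum F1) => i; apply: (familyX F1).
by apply: (familyB F1); [exact: (family_cst F1)|exact: (familyM F1)].
Qed.

Lemma near_idem_family m N (G : pt R n -> {poly R}) a : C1 G -> cont_pt a ->
  C1 (fun x => near_idem m N (G x) (a x)) /\ C1 (fun x => far_idem m N (G x) (a x)).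
Proof.
move=> CG Ca.
have gN : cont_pt (fun x => (G x).[a x] ^+ N) by apply: (familyX F0); exact: (family_horner F0 CG Ca).
have Cfar : C1 (fun x => far_idem m N (G x) (a x)).
  rewrite /far_idem; apply: (familyX F1); apply: (familyB F1); last exact: (familyX F1).
  exact: poly_familyC.
split=> //; rewrite /near_idem; apply: (familyB F1) => //; apply: poly_familyC => //; exact: (familyX F0).
Qed.

Lemma mix_family (Q : pt R n -> {poly {poly R}}) (E F : pt R n -> {poly R}) :
  C2 Q -> C1 E -> C1 F -> C2 (fun x => mix (Q x) (E x) (F x)).
Proof.
have lift (H : pt R n -> {poly R}) : C1 H -> C2 (fun x => map_poly polyC (H x)).
  move=> [[k Hk] CH]; split=> [|i].
    by exists k => x; rewrite (leq_trans (size_poly _ _)).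
  rewrite (_ : (fun x => _) = fun x => ((H x)`_i)%:P); first exact: poly_familyC.
  by apply: funext => x; rewrite coef_map.
by move=> CQ CE CF; apply: (familyD F2); [apply: (familyM F2) => //|]; exact: lift.
Qed.

Lemma norm_mod_family p' N (P H : pt R n -> {poly {poly R}}) :
  C2 P -> C2 H -> ((P x0)`_p'.+1).[0] != 0 -> C1 (fun x => norm_mod p' N (P x) (H x)).
Proof.
move=> CP CH lc0; apply: (family_det F1); apply: mx_family_horner => //.
have [_ Pi] := CP.
have CM : C2 (fun x => monicize p' N (P x)).
  apply: (familyD F2); first exact: (family_cst F2).
  apply: (poly_family_poly F1) => i; apply: (familyM F1) => //; exact: tinv_family.
move=> i j; rewrite (_ : (fun x => _) = fun x => if i == p' :> nat then
    - (monicize p' N (P x))`_j else (i.+1 == j :> nat)%:R); last first.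
  by apply: funext => x; rewrite mxE.
have [_ Mj] := CM.
by case: (nat_of_ord i == p'); [exact: (familyN F1)|exact: (family_cst F1)].
Qed.

(* The order of V cannot increase near x0; so if it stays below k while UV has
   order at least k, then U vanishes at 0. *)
Lemma near_coef0_eq0 (U V : pt R n -> {poly R}) k : C1 V ->
  near_pt (fun x => forall j, (j < k)%N -> (U x * V x)`_j = 0) ->
  (U x0 * V x0)`_k != 0 -> (U x0)`_0 = 0 -> near_pt (fun x => (U x)`_0 = 0).
Proof.
move=> [_ CV] low top U0.
(* Some term of the convolution of degree [k] is nonzero; as [U x0] has no constant term, its index
   [i] is positive. *)
have [i ui0 vi0] : exists2 i : 'I_k.+1, (U x0)`_i != 0 & (V x0)`_(k - i) != 0.
  apply: contrapT => none; move: top; rewrite coefM big1 ?eqxx // => i _; apply/eqP.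
  rewrite mulf_eq0; apply/negPn/negP; rewrite negb_or => /andP[ui vi].
  by apply: none; exists i.
have i_gt0 : (0 < i)%N by rewrite lt0n; apply: contraNneq ui0 => ->; rewrite U0.
apply: near_pt_imp (near_pt_and low (cont_pt_neq0 (CV (k - i)%N) vi0)) _ => x _ [lowx vx].
have exb : exists b, (V x)`_b != 0 by exists (k - i)%N.
(* [b] is the order of [V x], at most [k - i] and hence below [k]. The coefficient of degree [b] of
   the product vanishes and reduces to [b]-th coefficient of [V x] times constant term of [U x]. *)
case: (ex_minnP exb) => b vb bmin.
have ltbk : (b < k)%N.
  by rewrite (leq_ltn_trans (bmin _ vx)) // ltn_subrL i_gt0 (leq_trans i_gt0) // -ltnS.
have /eqP := lowx b ltbk; rewrite coefM big_ord_recl /= subn0 big1 ?addr0.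
  by rewrite mulf_eq0 (negPf vb) orbF => /eqP.
move=> j _; rewrite (_ : (V x)`_(b - lift ord0 j) = 0) ?mulr0 //.
apply/eqP/negPn/negP => /bmin; rewrite lift0 leqNgt ltn_subrL /=.
by rewrite (leq_trans _ (ltn_ord j)).
Qed.
End ContinuousFamily.

Lemma map_det_sylvester (A B : comNzRingType) (f : {rmorphism A -> B}) p q (P Q : {poly A}) :
  f (\det (sylvester p q P Q)) = \det (sylvester p q (map_poly f P) (map_poly f Q)).
Proof.
rewrite -det_map_mx; congr (\det _); apply/matrixP => i j.
rewrite mxE !sylvesterE; case: (split i) => k; rewrite coef_map.
  by rewrite raddfMn.
by rewrite raddfMn.
Qed.

(** * Local persistence of a common root *)

Section LocalConstancy.
Variables (R : realType) (n : nat) (S : pt R n -> Prop) (x0 : pt R n).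
Hypothesis Sx0 : S x0.
Variables (p q k m : nat) (P Q : {poly {mpoly R[n]}}) (th : pt R n -> R).
Hypotheses (szP : (size P <= p.+1)%N) (szQ : (size Q <= q.+1)%N).
Hypothesis lc0 : (P`_p).@[x0] != 0.
Hypothesis ordS : forall x, S x -> ord_is (\det (sylvester p q P Q)) x k.
Hypothesis m_gt0 : (0 < m)%N.
Hypothesis th_cont : cont_pt S x0 th.
Hypothesis mult_ge : near_pt S x0 (fun x => exists G, Eval x P = ('X - (th x)%:P) ^+ m * G).
Hypothesis mult_le : forall G, Eval x0 P <> ('X - (th x0)%:P) ^+ m.+1 * G.

(** [near_coef0_eq0] is applied to the near and far factors along a fixed line direction. Working
    modulo [t^(k+1)] keeps the coefficient of [t^k] visible. *)
Lemma near_common_root :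
  (Eval x0 Q).[th x0] = 0 -> near_pt S x0 (fun x => (Eval x Q).[th x] = 0).
Proof.
move=> Q0.
have [d dk] := ord_is_line (ordS Sx0).
pose PP x := map_poly (line idfun x d) P; pose QQ x := map_poly (line idfun x d) Q.
have at0 x (F : {poly {mpoly R[n]}}) :
    map_poly (horner_eval 0) (map_poly (line idfun x d) F) = Eval x F.
  rewrite -map_poly_comp; apply: eq_map_poly => c /=.
  by rewrite /horner_eval line_at0.
have [G0 G0E] := near_pt_center Sx0 mult_ge.
have G0a : G0.[th x0] != 0.
  apply/negP => /factor_theorem[J JE]; apply: (@mult_le J).
  by rewrite G0E JE exprS; ring.
have [p' pE] : exists p', p = p'.+1.
  exists p.-1; rewrite prednK // lt0n; apply/eqP => p0.
  have : (size (Eval x0 P) <= 1)%N by rewrite (leq_trans (size_poly _ _)) // -[1%N]/0.+1 -p0.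
  rewrite G0E size_monicM ?monic_exp ?monicXsubC //; last first.
    by apply: contraNneq G0a => ->; rewrite horner0.
  have : (0 < size G0)%N.
    by rewrite size_poly_gt0; apply: contraNneq G0a => ->; rewrite horner0.
  rewrite size_exp_XsubC addSn /= => sG; rewrite leqNgt => /negP; apply.
  by rewrite -add1n leq_add.
(* The cofactor of the root, obtained by translating, dropping [m] coefficients and translating
   back. It is defined for every [x], with coefficients continuous at [x0]. *)
pose Gf x : {poly R} :=
  drop_poly m (Eval x P \Po ('X + (th x)%:P)) \Po ('X - (th x)%:P).
have GfE x G : Eval x P = ('X - (th x)%:P) ^+ m * G -> Gf x = G.
  move=> E; rewrite /Gf E rmorphM rmorphXn /= rmorphB /= comp_polyX comp_polyC addrK mulrC.
  rewrite drop_polyMXn_id -comp_polyA rmorphD /= comp_polyX comp_polyC subrK.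
  by rewrite comp_polyXr.
pose F0 := cont_pt_subring S x0; pose F1 := poly_family_subring F0.
have CP := map_line_family S x0 d P : poly_family (poly_family (cont_pt S x0)) PP.
have CQ := map_line_family S x0 d Q : poly_family (poly_family (cont_pt S x0)) QQ.
have Cth : poly_family (cont_pt S x0) (fun x => (th x)%:P) by exact: poly_familyC.
have CE := Eval_family S x0 P.
have CG : poly_family (cont_pt S x0) Gf.
  apply: (poly_family_comp F0); last by apply: (familyB F1) => //; exact: (family_cst F1).
  apply: poly_family_drop; apply: (poly_family_comp F0) => //.
  by apply: (familyD F1) => //; exact: (family_cst F1).
have lcE x : ((PP x)`_p).[0] = (P`_p).@[x] by rewrite coef_map line_at0.
have near_lc : near_pt S x0 (fun x => ((PP x)`_p).[0] != 0).
  apply: cont_pt_neq0; first exact: (family_horner F0 (CP.2 p) (family_cst F0 0)).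
  by rewrite lcE.
have near_G : near_pt S x0 (fun x => (Gf x).[th x] != 0).
  apply: cont_pt_neq0; first exact: (family_horner F0 CG th_cont).
  by rewrite (GfE _ _ G0E).
have good := near_pt_and mult_ge (near_pt_and near_lc near_G).
pose U x := near_factor p' m k.+1 (PP x) (QQ x) (Gf x) (th x).
pose V x := far_factor p' m k.+1 (PP x) (QQ x) (Gf x) (th x).
have [Cnear Cfar] := near_idem_family m k.+1 CG th_cont.
have CV : poly_family (cont_pt S x0) V.
  by apply: norm_mod_family; [|exact: mix_family|rewrite -pE lcE].
have szPP x : (size (PP x) <= p'.+2)%N by rewrite (leq_trans (size_poly _ _)) // -pE.
have szQQ x : (size (QQ x) <= q.+1)%N by rewrite (leq_trans (size_poly _ _)).
have UV x : S x -> (exists G, Eval x P = ('X - (th x)%:P) ^+ m * G) /\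
      ((PP x)`_p).[0] != 0 /\ (Gf x).[th x] != 0 ->
    [/\ forall j, (j < k)%N -> (U x * V x)`_j = 0,
        (line idfun x d (\det (sylvester p q P Q)))`_k != 0 -> (U x * V x)`_k != 0
      & ((U x)`_0 == 0) = ((Eval x Q).[th x] == 0)].
  move=> Sx [[G GE] [lcx Gx]]; rewrite pE in lcx.
  have P0E : map_poly (horner_eval 0) (PP x) = ('X - (th x)%:P) ^+ m * Gf x.
    by rewrite at0 (GfE _ _ GE).
  have [W W0 [c UVE]] := near_far_factor (szPP x) (szQQ x) (ltn0Sn k) lcx P0E Gx.
  rewrite -/(U x) -/(V x) -map_det_sylvester -pE in UVE.
  have low := coef_line_lt d (ordS Sx).1.
  set r := line _ _ _ _ in UVE low *.
  (* The restricted resultant [r] has no term below [t^k], so up to that degree only the constant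
     term of [W] times the coefficient of [t^k] survives. *)
  have coefUV j : (j <= k)%N -> (U x * V x)`_j = W`_0 * r`_j *+ (j == k).
    move=> lejk; rewrite UVE coefD coefXnM ltnS lejk addr0 coefM big_ord_recl subn0 big1.
      rewrite addr0; case: eqVneq lejk => [->|nejk lejk]; first by rewrite mulr1n.
      by rewrite low ?mulr0 // ltn_neqAle nejk.
    move=> i _; rewrite low ?mulr0 // lift0 (leq_trans _ lejk) // ltn_subrL /=.
    by rewrite (leq_trans _ (ltn_ord i)).
  split=> [j ltjk||].
  - by rewrite coefUV ?(ltnW ltjk) // (ltn_eqF ltjk).
  - by move=> rk; rewrite coefUV // eqxx mulr1n mulf_neq0 // -horner_coef0.
  by rewrite -horner_coef0 (near_factor0 (QQ x) (szPP x) (ltn0Sn k) lcx P0E Gx m_gt0) at0.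
have nearU : near_pt S x0 (fun x => (U x)`_0 = 0).
  have [_ topx0 U0] := UV x0 Sx0 (near_pt_center Sx0 good).
  apply: near_coef0_eq0 CV _ (topx0 dk) _; last by apply/eqP; rewrite U0 Q0.
  by apply: near_pt_imp good _ => x Sx /(UV x Sx)[].
apply: near_pt_imp (near_pt_and good nearU) _ => x Sx [/(UV x Sx)[_ _ E] /eqP].
by rewrite E => /eqP.
Qed.
End LocalConstancy.

(** * The projective line and the main theorem *)

(** The top coefficient of a form is its value at [(1, 0)], and the substitution sends [(1, 0)] to
    [(1, lam)]. *)
Lemma coef_shear_top (A : comNzRingType) (lam : A) d (F : {poly A}) :
  (shear lam d F)`_d = hsub idfun d F 1 lam.
Proof.
have top e : ((1 + lam *: 'X : {poly A}) ^+ e)`_e = lam ^+ e.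
  elim: e => [|e IH]; first by rewrite !expr0 coefC.
  rewrite !exprS mulrDl mul1r coefD -scalerAl coefZ coefXM /= IH nth_default ?add0r //.
  by rewrite (leq_trans (size_exp_le _ (size_1DZX lam))) // muln1.
rewrite /shear /hsub coef_sum; apply: eq_bigr => i _.
by rewrite -mulrA coefCM mulrC coefXnM ltnNge -ltnS ltn_ord /= top expr1n mulr1 mulrC.
Qed.

Lemma hsub_shear (A B : comNzRingType) (f : {rmorphism A -> B}) lam d (F : {poly A}) a b :
  hsub f d (shear lam d F) a (b - f lam * a) = hsub f d F a b.
Proof.
rewrite /shear {2}/hsub hsub_sum; apply: eq_bigr => i _.
have led : (i <= d)%N by rewrite -ltnS.
rewrite -mulrA mul_polyC -[X in hsub f X _ _ _](subnKC led).
have hZ c e (G : {poly A}) x y : hsub f e (c *: G) x y = f c * hsub f e G x y.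
  by rewrite /hsub mulr_sumr; apply: eq_bigr => j _; rewrite coefZ rmorphM !mulrA.
rewrite hZ hsubM ?size_polyXn //; last first.
  by rewrite (leq_trans (size_exp_le _ (size_1DZX lam))) // muln1.
rewrite -['X^i]scale1r hsubZX // rmorph1 mul1r subnn expr0 mulr1 mulrA; congr (_ * _).
rewrite -{1}[(d - i)%N]muln1 hsubXn ?size_1DZX //; congr (_ ^+ _).
rewrite /hsub !big_ord_recl big_ord0 /= !coefD !coefZ !coefX !coefC /=.
rewrite !(rmorphD, rmorphM, rmorph0, rmorph1) /=; ring.
Qed.

Section ProjectiveLine.
Variable R : realType.
Implicit Types (w : R * R) (c : RP1 R).

Lemma rp_set_nonempty c : exists w, rp_set c w.
Proof. by have [w [_ ->]] := rp_ax c; exists w, 1; rewrite ?oner_neq0 // !mul1r; case: w. Qed.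

Lemma rp_set_prop c w w' : rp_set c w -> rp_set c w' ->
  exists2 l : R, l != 0 & w' = (l * w.1, l * w.2).
Proof.
have [v [_ ->]] := rp_ax c => -[l l0 ->] [l' l'0 ->] /=.
exists (l' / l); first by rewrite mulf_neq0 ?invr_eq0.
by congr pair; field.
Qed.

Lemma rp_set_scale c w l : rp_set c w -> l != 0 -> rp_set c (l * w.1, l * w.2).
Proof.
have [v [_ ->]] := rp_ax c => -[l' l'0 ->] l0 /=; exists (l * l'); first by rewrite mulf_neq0.
by rewrite !mulrA.
Qed.

Lemma rp_set_neq0 c w : rp_set c w -> w != (0, 0).
Proof.
have [v [v0 ->]] := rp_ax c => -[l l0 ->]; apply: contraNneq v0 => -[/eqP e1 /eqP e2].
move: e1 e2; rewrite !mulf_eq0 (negPf l0) /= => /eqP e1 /eqP e2.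
by rewrite [v]surjective_pairing e1 e2.
Qed.

Variable lam : R.

(* The affine coordinate u / (v - lam u) of the chart whose point at infinity is (1 : lam). *)
Definition chart c : R := let w := projT1 (cid (rp_set_nonempty c)) in w.1 / (w.2 - lam * w.1).

Lemma chartE c w : rp_set c w -> chart c = w.1 / (w.2 - lam * w.1).
Proof.
rewrite /chart; case: cid => v cv cw /=; have [l l0 ->] := rp_set_prop cv cw => /=.
rewrite [lam * (l * _)]mulrCA -mulrBr invfM mulrACA divff // mul1r.
by [].
Qed.

Lemma chart_rep c w : rp_set c w -> w.2 - lam * w.1 != 0 ->
  rp_set c (chart c, 1 + lam * chart c).
Proof.
move=> cw fin; rewrite (chartE cw).
have -> : (w.1 / (w.2 - lam * w.1), 1 + lam * (w.1 / (w.2 - lam * w.1))) =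
    ((w.2 - lam * w.1)^-1 * w.1, (w.2 - lam * w.1)^-1 * w.2).
  by congr pair; field.
by apply: rp_set_scale; rewrite ?invr_eq0.
Qed.

(** Continuity into [RP1] is stated with open sets; these chart neighbourhoods turn it into an
    estimate on the affine coordinate. *)
Lemma rp1_open_chart (t e : R) : rp1_open (fun c => exists w, 
  [/\ rp_set c w, w.2 - lam * w.1 != 0 & `|w.1 / (w.2 - lam * w.1) - t| < e]).
Proof.
move=> w _ [c [[w' [cw' fin' dist']] cw]].
have [fin dist] : w.2 - lam * w.1 != 0 /\ `|w.1 / (w.2 - lam * w.1) - t| < e.
  rewrite -(chartE cw) (chartE cw'); split=> //.
  have [l l0 ->] := rp_set_prop cw' cw => /=.
  by rewrite [lam * _]mulrCA -mulrBr mulf_neq0.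
(* Pairs are read as points of [pt R 2], so that continuity of quotients on the plane follows from
   the lemmas on [cont_pt]. *)
pose x0 : pt R 2 := fun i => if i == 0 then w.1 else w.2.
pose den (x : pt R 2) := x 1 - lam * x 0.
pose F0 := cont_pt_subring (fun _ => True) x0.
have cden : cont_pt (fun _ => True) x0 den.
  apply: (familyB F0); first exact: cont_pt_coord.
  by apply: (familyM F0); [exact: (family_cst F0)|exact: cont_pt_coord].
have cq : cont_pt (fun _ => True) x0 (fun x => x 0 / den x).
  by apply: (familyM F0); [exact: cont_pt_coord|exact: cont_ptV].
have e0 : 0 < e - `|w.1 / (w.2 - lam * w.1) - t| by rewrite subr_gt0.
have [r r0 near] := near_pt_and (cont_pt_neq0 cden fin) (cq _ e0).
exists r => // v v1 v2.
have [] := near (fun i => if i == 0 then v.1 else v.2) I.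
  by move=> i; rewrite /x0; case: ifP.
rewrite /den /x0 /= => finv distv.
have v0 : v != (0, 0) by apply: contraNneq finv => ->; rewrite /= mulr0 subrr.
split=> //; exists (MkRP1 (ex_intro _ v (conj v0 erefl))).
have cv : pclass v v by exists 1; rewrite ?oner_neq0 // !mul1r -surjective_pairing.
split=> //; exists v; split=> //.
have := ler_normD (v.1 / (v.2 - lam * v.1) - w.1 / (w.2 - lam * w.1)) (w.1 / (w.2 - lam * w.1) - t).
rewrite addrA subrK => h; lra.
Qed.
End ProjectiveLine.

(** * Binary forms and their roots in the sheared chart *)

Section Hval.
Variables (R : realType) (n : nat).
Implicit Types (x : pt R n) (P Q : {poly {mpoly R[n]}}) (lam : R).

Lemma HvalE d P x w : Hval d P x w = hsub (meval x) d P w.1 w.2.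
Proof. by []. Qed.

Lemma Hval_scale d P x l w : Hval d P x (l * w.1, l * w.2) = l ^+ d * Hval d P x w.
Proof. by rewrite !HvalE hsub_scale. Qed.

Lemma Hval_rep c d P x w w' : rp_set c w -> rp_set c w' -> Hval d P x w = 0 -> Hval d P x w' = 0.
Proof. by move=> cw /(rp_set_prop cw)[l _ ->]; rewrite Hval_scale => ->; rewrite mulr0. Qed.

Lemma Eval_shear lam d P x : Eval x (shear lam%:MP d P) = shear lam d (Eval x P).
Proof.
rewrite /Eval /shear (rmorph_hsub (h := polyC \o meval x)) => [|c]; last by rewrite /= map_polyC.
rewrite /= map_polyX rmorphD rmorph1 /= map_polyZ /= map_polyX mevalC.
by apply: eq_bigr => i _; rewrite coef_map.
Qed.

Lemma horner_Eval_shear lam d P x t :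
  (Eval x (shear lam%:MP d P)).[t] = Hval d P x (t, 1 + lam * t).
Proof.
rewrite Eval_shear -[LHS]/(horner_eval t _) /shear (rmorph_hsub (h := idfun)) => [|c]; last first.
  by rewrite /= /horner_eval hornerC.
rewrite /= /horner_eval !hornerE HvalE /=.
by apply: eq_bigr => i _; rewrite coef_map.
Qed.

(** The value at [(1, lam)] is a polynomial in [lam] whose coefficients are those of [Eval x P] in
    reverse order. *)
Lemma Hval_nonroot d P x : (size P <= d.+1)%N -> Eval x P != 0 ->
  exists lam, Hval d P x (1, lam) != 0.
Proof.
move=> szP nz; apply: contrapT => /forallNP all0.
suff E : \poly_(i < d.+1) ((P`_(d - i)).@[x]) = 0.
  move/eqP: nz; apply; apply/polyP => i; rewrite coef_map coef0 /=.
  have [led|gtd] := leqP i d; last by rewrite nth_default ?raddf0 // (leq_trans szP).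
  have := congr1 (fun p : {poly R} => p`_(d - i)) E.
  by rewrite coef_poly coef0 ltnS leq_subr subKn.
apply: poly_eq0_forall => t; rewrite horner_poly.
have /negP/negPn/eqP := all0 t; apply: etrans; rewrite /Hval [RHS](reindex_inj rev_ord_inj) /=.
apply: eq_bigr => i _; rewrite subSS expr1n mulr1 subKn // -ltnS //.
Qed.

Lemma EhomE d P x : Ehom d P x = hsub (polyC \o polyC \o meval x) d P 'X 'X%:P.
Proof.
apply: eq_bigr => k _ /=; rewrite -mul_polyC polyCM polyC_exp; ring.
Qed.

Lemma Ehom_dehom lam d P x w h m : Ehom d P x = linform (w, 1 + lam * w) ^+ m * h ->
  exists G, Eval x (shear lam%:MP d P) = ('X - w%:P) ^+ m * G.
Proof.
(* [psi] puts [u := 'X] and [v := 1 + lam *: 'X]; the linear form of [(w, 1 + lam w)] becomes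
   ['X - w]. *)
move=> E; pose psi := horner_eval ('X : {poly R}) \o map_poly (comp_poly (1 + lam *: 'X)).
exists (psi h).
have -> : 'X - w%:P = psi (linform (w, 1 + lam * w)).
  rewrite /psi /linform /= rmorphB rmorphM /= !map_polyC /= map_polyX /horner_eval !hornerE /=.
  rewrite !comp_polyC linearZ /= comp_polyX -!mul_polyC polyCD polyCM; ring.
rewrite -rmorphXn -rmorphM -E EhomE (rmorph_hsub (h := polyC \o meval x)) => [|c]; last first.
  by rewrite /psi /= !map_polyC /= /horner_eval hornerC comp_polyC.
rewrite Eval_shear /psi /= map_polyX map_polyC /= /horner_eval !hornerE comp_polyX.
by apply: eq_bigr => i _; rewrite coef_map.
Qed.

(** Homogenizing at [(u, v - lam u)] undoes the shear. The nonzero top coefficient makes [d] the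
    true degree, so [d] splits as [m] plus the degree of [G] and [hsubM] applies. *)
Lemma Ehom_rehom lam d P x w m G : (Eval x (shear lam%:MP d P))`_d != 0 ->
  Eval x (shear lam%:MP d P) = ('X - w%:P) ^+ m * G ->
  bf_divides (linform (w, 1 + lam * w) ^+ m) (Ehom d P x).
Proof.
move=> lc E; set P1 := Eval x _ in lc E.
have szP1 : size P1 = d.+1.
  apply/eqP; rewrite eqn_leq; apply/andP; split; first by rewrite /P1 Eval_shear size_shear.
  by rewrite ltnNge; apply: contra lc => /leq_sizeP ->.
have G0 : G != 0 by apply: contraNneq lc => G0; rewrite E G0 mulr0 coef0.
have dE : d = (m * 1 + (size G).-1)%N.
  have := szP1; rewrite E size_monicM ?monic_exp ?monicXsubC // size_exp_XsubC addSn /= muln1.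
  by rewrite -(prednK (n := size G)) ?size_poly_gt0 // addnS => -[].
exists (hsub (polyC \o polyC) (size G).-1 G 'X ('X%:P - lam%:P%:P * 'X)).
have -> : Ehom d P x = hsub (polyC \o polyC) d P1 'X ('X%:P - lam%:P%:P * 'X).
  rewrite /P1 Eval_shear hsub_shear EhomE.
  by apply: eq_bigr => i _; rewrite coef_map.
rewrite E [X in hsub _ X]dE hsubM ?leqSpred //; last first.
  by rewrite size_exp_XsubC muln1.
rewrite hsubXn ?size_XsubC //; congr (_ ^+ _ * _).
rewrite /linform /hsub !big_ord_recl big_ord0 /= !coefB !coefX !coefC /=.
rewrite -mul_polyC !(polyCD, polyCB, polyCM, polyC0, polyC1); ring.
Qed.
End Hval.

Section Chart.
Variables (R : realType) (n : nat) (S : pt R n -> Prop) (p q k : nat) (P Q : {poly {mpoly R[n]}}).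
Variables (theta : pt R n -> RP1 R) (mu : nat).
Hypotheses (szP : (size P <= p.+1)%N) (szQ : (size Q <= q.+1)%N).
Hypothesis P_neq0 : never_nullifies S P.
Hypothesis ordS : forall x, S x -> ord_is (\det (sylvester p q P Q)) x k.
Hypothesis theta_cont : continuous_on_RP1 S theta.
Hypothesis theta_root : forall x, S x -> forall w, rp_set (theta x) w -> Hval p P x w = 0.
Hypothesis mu_gt0 : (0 < mu)%N.
Hypothesis theta_mult : forall x, S x -> proj_root_mult (Ehom p P x) (theta x) mu.

Definition vanishes x := forall w, rp_set (theta x) w -> Hval q Q x w = 0.

Lemma vanishes_rep x w : rp_set (theta x) w -> vanishes x <-> Hval q Q x w = 0.
Proof.
move=> tw; split=> [|Q0 w' tw']; first exact.
exact: Hval_rep tw tw' Q0.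
Qed.

(** A chart whose point at infinity is not a root of [P] at [x0] makes the root function an affine
    function near [x0], with the multiplicities carried over. *)
Lemma near_vanishes x0 : S x0 ->
  near_pt S x0 (fun x => vanishes x <-> vanishes x0).
Proof.
move=> Sx0; have [lam lamP] := Hval_nonroot szP (P_neq0 Sx0).
pose th x := chart lam (theta x).
(* A representative at infinity would be a nonzero multiple of [(1, lam)], where the form of [P]
   does not vanish. *)
have fin0 w : rp_set (theta x0) w -> w.2 - lam * w.1 != 0.
  move=> tw; apply/negP; rewrite subr_eq0 => /eqP w2; move/eqP: (theta_root Sx0 tw).
  have -> : Hval p P x0 w = Hval p P x0 (w.1 * 1, w.1 * lam).
    by rewrite mulr1 [w.1 * lam]mulrC -w2 -surjective_pairing.
  rewrite (Hval_scale p P x0 w.1 (1, lam)) mulf_eq0 (negPf lamP) orbF expf_eq0 => /andP[_ /eqP w1].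
  by move: (rp_set_neq0 tw); rewrite [w]surjective_pairing w2 w1 mulr0 eqxx.
have near_e (e : R) : 0 < e -> near_pt S x0 (fun x =>
    rp_set (theta x) (th x, 1 + lam * th x) /\ `|th x - th x0| < e).
  move=> e0; have [_ opn] := theta_cont (@rp1_open_chart R lam (th x0) e).
  have [w0 tw0] := rp_set_nonempty (theta x0).
  have [|r r0 near] := opn x0.
    split=> //; exists w0; split=> //; first exact: fin0.
    by rewrite -(chartE lam tw0) subrr normr0.
  exists r => // x Sx xr; have [_ [w [tw fin dist]]] := near x Sx xr.
  by split; [exact: chart_rep tw fin | rewrite /th (chartE lam tw)].
have th_cont : cont_pt S x0 th by move=> e e0; apply: near_pt_imp (near_e e e0) _ => x _ [].
have rep := near_pt_imp (near_e 1 ltr01) (fun x _ => @proj1 _ _).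
have lc0 : ((shear lam%:MP p P)`_p).@[x0] != 0.
  rewrite coef_shear_top; move: lamP; rewrite HvalE -[_.@[x0]]/(meval x0 _).
  rewrite (rmorph_hsub (h := meval x0)) //= rmorph1 mevalC //.
have rep0 := near_pt_center Sx0 rep.
have vanE x : rp_set (theta x) (th x, 1 + lam * th x) ->
    vanishes x <-> (Eval x (shear lam%:MP q Q)).[th x] = 0.
  by move=> tw; rewrite horner_Eval_shear; exact: vanishes_rep.
(* Nonvanishing persists by continuity alone; the persistence of vanishing rests on the order of the
   resultant. *)
have [Q0|Qn0] := pselect (vanishes x0); last first.
  have cQ : cont_pt S x0 (fun x => (Eval x (shear lam%:MP q Q)).[th x]).
    exact: (family_horner (cont_pt_subring S x0) (Eval_family S x0 _) th_cont).
  have nz : (Eval x0 (shear lam%:MP q Q)).[th x0] != 0.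
    by apply/eqP => /(vanE _ rep0).
  apply: near_pt_imp (near_pt_and rep (cont_pt_neq0 cQ nz)) _ => x _ [tw /eqP nzx].
  by split=> // /(vanE _ tw).
have : near_pt S x0 (fun x => (Eval x (shear lam%:MP q Q)).[th x] = 0).
  apply: (@near_common_root R n S x0 Sx0 p q k mu (shear lam%:MP p P)) => //.
  - exact: size_shear.
  - exact: size_shear.
  - by move=> x Sx; rewrite det_sylvester_shear //; exact: ordS.
  - apply: near_pt_imp rep _ => x Sx tw.
    have [_ [[h hE] _]] := theta_mult Sx tw.
    exact: Ehom_dehom hE.
  - move=> G GE; have [_ [_ max]] := theta_mult Sx0 rep0.
    have := max mu.+1; rewrite ltnn => /(_ _)/notF; apply.
    by apply: Ehom_rehom GE; rewrite coef_map.
  - exact/(vanE _ rep0).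
move=> Qnear; apply: near_pt_imp (near_pt_and rep Qnear) _ => x _ [tw Qx].
by split=> // _; exact/(vanE _ tw).
Qed.
End Chart.

Theorem mainTheorem11 (R : realType) (n : nat) (S : pt R n.-1 -> Prop)
    (P Q : {poly {mpoly R[n.-1]}}) :
  (0 < n)%N ->
  analytic_submanifold S -> connected S ->
  (0 < degn P)%N -> (0 < degn Q)%N ->
  never_nullifies S P -> never_nullifies S Q ->
  proj_delineable S P ->
  resultant P Q != 0 -> order_invariant S (resultant P Q) ->
  forall (k : nat) (theta : 'I_k -> pt R n.-1 -> RP1 R),
    proj_delin_family S P theta ->
    forall l : 'I_k,
      (forall x, S x -> forall w, rp_set (theta l x) w -> Hval (degn Q) Q x w = 0) \/
      (forall x, S x -> forall w, rp_set (theta l x) w -> Hval (degn Q) Q x w != 0).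
Proof.
move=> _ _ conn _ _ nP _ _ _ [r ordS] k theta [cont [roots [_ mults]]] l.
have [mu mu_gt0 multl] := mults l.
have root_l x : S x -> forall w, rp_set (theta l x) w -> Hval (degn P) P x w = 0.
  by move=> Sx w tw; apply/(roots x Sx w (rp_set_neq0 tw)); exists l.
have szP := leqSpred (size P); have szQ := leqSpred (size Q).
(* By definition, [resultant P Q] is the determinant of [sylvester] with formal degrees [degn P] and
   [degn Q]. *)
have near := near_vanishes szP szQ nP ordS (cont l) root_l mu_gt0 multl.
(* The vanishing locus and its complement in [S] are both relatively open, because vanishing is
   locally constant. *)
have [] := conn (fun x => S x /\ vanishes (degn Q) Q (theta l) x).
- split=> [x []//|a [Sa va]]; have [e e0 near_a] := near a Sa.
  by exists e => // x Sx /(near_a x Sx) vx; split=> //; apply/vx.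
- split=> [x []//|a [Sa va]]; have [e e0 near_a] := near a Sa.
  exists e => // x Sx /(near_a x Sx) vx; split=> // -[_ /vx vax].
  by apply: va.
- move=> none; right=> x Sx w tw; apply/eqP => Q0; apply: (none x); split=> //.
  exact/(vanishes_rep _ _ tw).
- by move=> all0; left=> x Sx; have [] := all0 x Sx.
Qed.
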